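(* Let $X\sim\mathcal N(0,\Sigma_X)$ in $\mathbb R^k$ with $\Sigma_X\succ0$, and let $Z_j=H_jX+W_j$, $j=1,2,\dots$, where $W_j\sim\mathcal N(0,R_j)$, $R_j\succ0$, are independent of each other and of $X$. Put $Z^{(m)}=(Z_1,\dots,Z_m)$, $S^{(m)}=\mathbb E[X\mid Z^{(m)}]$, $\Sigma_S^{(m)}=\mathrm{Cov}(S^{(m)})$, $J_m=\sum_{j=1}^mH_j^\top R_j^{-1}H_j$ and $G_m=\left(\det\Sigma_S^{(m)}/\det\Sigma_X\right)^{1/k}$. Then: (1) $\Sigma_{X\mid Z^{(m)}}^{-1}=\Sigma_X^{-1}+J_m$ and $\Sigma_S^{(m)}=\Sigma_X-\Sigma_{X\mid Z^{(m)}}$. (2) $\Sigma_{X\mid Z^{(m)}}$ is monotone decreasing in $m$ in the Loewner order and $\Sigma_S^{(m)}$ is monotone increasing in $m$ (both in the non-strict sense). (3) If $J_m\succ0$ (equivalently $\mathrm{Null}(J_m)=\{0\}$), then $0\prec\Sigma_{X\mid Z^{(m)}}\prec\Sigma_X$ and $0\prec\Sigma_S^{(m)}\prec\Sigma_X$, hence $G_m\in(0,1)$. (4) If in addition $\lambda_{\min}(J_m)\to\infty$ as $m\to\infty$, then $\Sigma_{X\mid Z^{(m)}}\to0$, $\Sigma_S^{(m)}\to\Sigma_X$ and $G_m\to1$.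
   Context: $\Sigma_{X\mid U}=\mathbb E[(X-\mathbb E[X\mid U])(X-\mathbb E[X\mid U])^\top]$ is the average MMSE error covariance. $A\preceq B$ (resp. $A\prec B$) means $B-A$ is positive semidefinite (resp. definite). $\lambda_{\min}$ is the smallest eigenvalue. *)

(* Defs.v *)
From HB Require Import structures.
From mathcomp Require Import all_boot all_order all_algebra.
From mathcomp Require Import finmap.
From mathcomp Require Import all_classical all_reals all_analysis.

Set Implicit Arguments.
Unset Strict Implicit.
Unset Printing Implicit Defensive.

Import Order.TTheory GRing.Theory Num.Theory.
Import numFieldNormedType.Exports.

Local Open Scope classical_set_scope.
Local Open Scope ring_scope.

Definition psdmx (R : realType) (k : nat) (A : 'M[R]_k) : Prop :=
  A^T = A /\ forall v : 'cV[R]_k, 0 <= (v^T *m A *m v) ord0 ord0.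

Definition pdmx (R : realType) (k : nat) (A : 'M[R]_k) : Prop :=
  A^T = A /\
  forall v : 'cV[R]_k, v != 0 -> 0 < (v^T *m A *m v) ord0 ord0.

Definition loewner_le (R : realType) (k : nat) (A B : 'M[R]_k) : Prop :=
  psdmx (B - A).

Definition loewner_lt (R : realType) (k : nat) (A B : 'M[R]_k) : Prop :=
  pdmx (B - A).

(* For k > 0 and A symmetric, the set of eigenvalues is finite and nonempty,
   so this infimum is the smallest eigenvalue. *)
Definition lambda_min (R : realType) (k : nat) (A : 'M[R]_k) : R :=
  inf [set a : R | eigenvalue A a].

(* A random vector is a function X : T -> 'cV[R]_k with measurable coordinates;
   the library puts no sigma-algebra on 'cV[R]_k. *)
Definition coord (R : realType) (T : Type) (k : nat) (X : T -> 'cV[R]_k)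
  (i : 'I_k) : T -> R := fun t => X t i ord0.

Definition random_vector (d : measure_display) (T : measurableType d)
    (R : realType) (k : nat) (X : T -> 'cV[R]_k) : Prop :=
  forall i, measurable_fun [set: T] (coord X i).

(* The sigma-algebra sigma(X) on T. *)
Definition sigma_rv (d : measure_display) (T : measurableType d)
    (R : realType) (k : nat) (X : T -> 'cV[R]_k) : set (set T) :=
  g_sigma_preimage (coord X).

(* N(m, v) on R, v being the variance. The case v = 0 is the point mass at m;
   the library's normal_prob takes the standard deviation and has a junk value
   when it is 0. *)
Definition normal_law (R : realType) (m v : R) (A : set R) : \bar R :=
  if v == 0 then \d_m A else normal_prob m (Num.sqrt v) A.

(* X ~ N(mu, Sigma): every linear form u^T X has law
   N(u^T mu, u^T Sigma u). *)
Definition gaussian_vector (d : measure_display) (T : measurableType d)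
    (R : realType) (P : probability T R) (k : nat) (X : T -> 'cV[R]_k)
    (mu : 'cV[R]_k) (Sigma : 'M[R]_k) : Prop :=
  [/\ random_vector X, psdmx Sigma &
    forall (u : 'cV[R]_k) (A : set R), measurable A ->
      P ((fun t => (u^T *m X t) ord0 ord0) @^-1` A) =
      normal_law ((u^T *m mu) ord0 ord0) ((u^T *m Sigma *m u) ord0 ord0) A].

Definition mutually_independent (d : measure_display) (T : measurableType d)
    (R : realType) (P : probability T R) (I : choiceType)
    (F : I -> set (set T)) : Prop :=
  forall (J : {fset I}) (A : I -> set T), (forall i, i \in J -> F i (A i)) ->
    P (\bigcap_(i in [set` J]) A i) = (\prod_(i <- J) P (A i))%E.

(* S is a version of E[X | U], coordinate by coordinate. *)
Definition is_cond_exp (d : measure_display) (T : measurableType d)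
    (R : realType) (P : probability T R) (k n : nat)
    (X : T -> 'cV[R]_k) (U : T -> 'cV[R]_n) (S : T -> 'cV[R]_k) : Prop :=
  forall i : 'I_k,
    [/\ preimage_set_system [set: T] (coord S i) measurable `<=` sigma_rv U,
        P.-integrable [set: T] (EFin \o coord S i) &
        forall A : set T, sigma_rv U A ->
          (\int[P]_(t in A) (coord S i t)%:E =
           \int[P]_(t in A) (coord X i t)%:E)%E].

(* E[X | U]: a chosen version. Versions exist as soon as X is integrable, and
   any two agree almost surely; the default value 0 is used only when there is
   none. *)
Definition cond_exp (d : measure_display) (T : measurableType d)
    (R : realType) (P : probability T R) (k n : nat)
    (X : T -> 'cV[R]_k) (U : T -> 'cV[R]_n) : T -> 'cV[R]_k :=
  xget (fun=> 0) [set S | is_cond_exp P X U S].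

Definition expectation_mx (d : measure_display) (T : measurableType d)
    (R : realType) (P : probability T R) (p q : nat)
    (M : T -> 'M[R]_(p, q)) : 'M[R]_(p, q) :=
  \matrix_(i, j) fine ('E_P[fun t => M t i j])%E.

Definition covariance_mx (d : measure_display) (T : measurableType d)
    (R : realType) (P : probability T R) (k : nat)
    (X : T -> 'cV[R]_k) : 'M[R]_k :=
  \matrix_(i, j) fine (covariance P (coord X i) (coord X j)).

(* Sigma_{X|U}, the average MMSE error covariance. *)
Definition mmse_cov (d : measure_display) (T : measurableType d)
    (R : realType) (P : probability T R) (k n : nat)
    (X : T -> 'cV[R]_k) (U : T -> 'cV[R]_n) : 'M[R]_k :=
  expectation_mx P (fun t =>
    (X t - cond_exp P X U t) *m (X t - cond_exp P X U t)^T).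

(* Main.v *)
(* Fix m and put C = (Sigma_X^-1 + J_m)^-1 and S = C \sum_j H_j^T R_j^-1 Z_j.
   Every coordinate of X - S and of Z^(m) is a linear form in the independent
   Gaussian vectors X, W_0, W_1, ..., so the Fourier transform of any combination
   of them is exp(-q/2), with q the variance. As X - S and Z^(m) are uncorrelated,
   q splits, and differentiating at 0 in the direction of a coordinate Y of X - S
   gives E[Y cos(s.Z^(m) + c)] = 0 for all s and c. Uniqueness of Fourier
   transforms of finite signed measures turns this into E[Y 1_A] = 0 for A in
   sigma(Z^(m)), i.e. E[X | Z^(m)] = S almost surely; second moments, also read
   off the Fourier transforms, then give Sigma_{X|Z^(m)} = C and
   Sigma_S^(m) = Sigma_X - C. The rest is linear algebra: inversion reverses the
   Loewner order, the determinant is strictly monotone on definite matrices (Schur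
   complements), and lambda_min(J_m) I <= J_m yields C <= lambda_min(J_m)^-1 I. *)

Require Import Defs.
From HB Require Import structures.
From mathcomp Require Import all_boot all_order all_algebra.
From mathcomp Require Import finmap.
From mathcomp Require Import all_classical all_reals all_analysis.
From mathcomp Require Import measurable_realfun ring lra.

Set Implicit Arguments.
Unset Strict Implicit.
Unset Printing Implicit Defensive.

Import Order.TTheory GRing.Theory Num.Theory.
Import numFieldNormedType.Exports.

Local Open Scope classical_set_scope.
Local Open Scope ring_scope.

(* The bare name denotes vector.coord here. *)
Local Notation coord := Defs.coord.

(** * Integrals *)

(** The argument stays real: in cos(s.Z + c) the free phase c carries cosine and sine together, and
    the product-to-sum formula keeps products of cosines in the same class. Uniqueness rests on
    this. The weights g for which F g has zero transform are stable under multiplication by cos(r z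
    + e), so they contain the polynomials in such a cosine and, by bounded limits, the indicator of
    the set where it is negative; cosines of low frequency then give the rays. Vectors are treated
    one coordinate at a time, each indicator being absorbed into F. Independence is given for events
    only, so the induction that multiplies Fourier transforms carries an event along. Integrability
    of a Gaussian form and of its square has to be proved: the bounded functions n sin(x/n), which
    tend to x and are at most |x| in absolute value, extract the moments from the Fourier transform.
    Existence of a conditional expectation comes from the explicit linear candidate, which also
    keeps [cond_exp] off its default value. *)

Section integral_toolkit.
Context d (T : measurableType d) (R : realType) (mu : {measure set T -> \bar R}).

Lemma Rintegral_dominated_cvg (f_ : nat -> T -> R) (f g : T -> R) :
  (forall n, measurable_fun setT (f_ n)) ->
  (forall x, f_ n x @[n --> \oo] --> f x) ->
  mu.-integrable setT (EFin \o g) ->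
  (forall n x, `|f_ n x| <= g x) ->
  mu.-integrable setT (EFin \o f) /\
  (\int[mu]_x f_ n x) @[n --> \oo] --> \int[mu]_x f x.
Proof.
move=> mf_ ff ig fg.
have mf : measurable_fun setT f.
  apply: (measurable_fun_cvg mf_) => x _; exact: ff.
have [] := @dominated_convergence _ _ _ mu setT measurableT
  (fun n => EFin \o f_ n) (EFin \o f) (EFin \o g).
- by move=> n; exact/measurable_EFinP.
- exact/measurable_EFinP.
- apply: aeW => x _; apply: cvg_EFin; first exact: nearW.
  exact: ff.
- by [].
- by apply: aeW => x n _ /=; rewrite lee_fin.
move=> intf _ cvf; split=> //.
apply: fine_cvg; rewrite fineK//; exact: integrable_fin_num.
Qed.

Lemma integrable_mul_bounded (F g : T -> R) (M : R) :
  mu.-integrable setT (EFin \o F) -> measurable_fun setT g ->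
  (forall x, `|g x| <= M) -> mu.-integrable setT (EFin \o (F \* g)).
Proof.
move=> iF mg gM; have mF : measurable_fun setT F.
  by apply/measurable_EFinP; exact: measurable_int iF.
apply: (le_integrable _ _ _ (integrableZl measurableT M (integrable_norm iF))) => //.
  by apply/measurable_EFinP; exact: measurable_funM.
move=> x _ /=; rewrite lee_fin normrM normrM normr_id mulrC.
by apply: ler_wpM2r => //; apply: le_trans (gM x) _; exact: ler_norm.
Qed.

Lemma Rintegral_sum I (r : seq I) (f : I -> T -> R) :
  (forall i, mu.-integrable setT (EFin \o f i)) ->
  \int[mu]_x (\sum_(i <- r) f i x) = \sum_(i <- r) \int[mu]_x f i x.
Proof.
move=> intf; elim: r => [|i r ih].
  rewrite big_nil; under eq_Rintegral do rewrite big_nil.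
  by rewrite Rintegral_cst// mul0r.
rewrite big_cons -ih; under eq_Rintegral do rewrite big_cons.
rewrite RintegralD//.
rewrite (_ : _ \o _ = (fun x => (\sum_(j <- r) (f j x)%:E)%E)); last first.
  by apply/funext => x /=; rewrite sumEFin.
apply: (@integrable_sum _ _ _ _ _ measurableT _ r xpredT (fun j x => (f j x)%:E)).
by move=> j _; exact: intf.
Qed.

End integral_toolkit.

Section signed_measure.
Import HBNNSimple.

(* The two sides define the same finite signed measure on T0. *)
Lemma Rintegral_transfer d0 (T0 : measurableType d0) d1 (T1 : measurableType d1)
    d2 (T2 : measurableType d2) (R : realType)
    (mu1 : {measure set T1 -> \bar R}) (mu2 : {measure set T2 -> \bar R})
    (F1 : T1 -> R) (F2 : T2 -> R) (a1 : T1 -> T0) (a2 : T2 -> T0) :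
  mu1.-integrable setT (EFin \o F1) -> mu2.-integrable setT (EFin \o F2) ->
  measurable_fun setT a1 -> measurable_fun setT a2 ->
  (forall B, measurable B ->
     \int[mu1]_x (F1 x * \1_B (a1 x)) = \int[mu2]_x (F2 x * \1_B (a2 x))) ->
  forall (g : T0 -> R) (M : R), measurable_fun setT g -> (forall x, `|g x| <= M) ->
     \int[mu1]_x (F1 x * g (a1 x)) = \int[mu2]_x (F2 x * g (a2 x)).
Proof.
move=> iF1 iF2 ma1 ma2 eqB g M mg gM.
(* The shift makes the function nonnegative, hence an increasing limit of simple functions. It is
   undone at the end: the hypothesis at the full set says that F1 and F2 have the same integral. *)
pose h x := g x + M.
have h0 x : 0 <= h x by rewrite /h -lerBlDr sub0r; have := gM x; rewrite ler_norml => /andP[].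
have hM x : h x <= M + M by rewrite /h lerD2r; have := gM x; rewrite ler_norml => /andP[].
have mh : measurable_fun setT (EFin \o h).
  by apply/measurable_EFinP; exact: measurable_funD.
pose s := nnsfun_approx measurableT mh.
have s_le n x : s n x <= M + M.
  apply: le_trans (hM x); rewrite -lee_fin.
  have := @le_approx _ _ _ setT (EFin \o h) n x (fun x _ => h0 x) I.
  by rewrite /s nnsfun_approxE.
have s_ge0 n x : 0 <= s n x by [].
have s_cvg x : s n x @[n --> \oo] --> h x.
  have /fine_cvg := @cvg_nnsfun_approx _ _ _ setT measurableT (EFin \o h) mh
    (fun x _ => h0 x) x I.
  exact.
have sM n x : `|s n x| <= M + M by rewrite ger0_norm.
have eqs n : \int[mu1]_x (F1 x * s n (a1 x)) = \int[mu2]_x (F2 x * s n (a2 x)).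
  have gen d' (T' : measurableType d') (mu' : {measure set T' -> \bar R})
      (F : T' -> R) (a : T' -> T0) : mu'.-integrable setT (EFin \o F) ->
      measurable_fun setT a ->
      let r := (fset_set (s n @` setT)) in
      \int[mu']_x (F x * s n (a x)) = \sum_(i < #|`r|)
        r`_i * \int[mu']_x (F x * \1_(s n @^-1` [set r`_i]) (a x)).
    move=> iF ma r.
    have iFB B : measurable B ->
        mu'.-integrable setT (EFin \o (fun x => F x * \1_B (a x))).
      move=> mB; apply: (@integrable_mul_bounded _ _ _ _ _ _ 1 iF).
        by apply: measurableT_comp => //; exact: measurable_indic.
      by move=> x; rewrite indicE ger0_norm// lern1; case: (_ \in _).
    under eq_Rintegral => x _.
      rewrite fimfunEord -/r mulr_sumr.
      under eq_bigr do rewrite mulrCA.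
      over.
    rewrite Rintegral_sum.
      by apply: eq_bigr => i _; rewrite RintegralZl//; exact: iFB.
    move=> i; exact: (integrableZl measurableT _ (iFB _ _)).
  rewrite !gen//; apply: eq_bigr => i _; rewrite eqB//.
have eqh : \int[mu1]_x (F1 x * h (a1 x)) = \int[mu2]_x (F2 x * h (a2 x)).
  have gen d' (T' : measurableType d') (mu' : {measure set T' -> \bar R})
      (F : T' -> R) (a : T' -> T0) : mu'.-integrable setT (EFin \o F) ->
      measurable_fun setT a ->
      \int[mu']_x (F x * s n (a x)) @[n --> \oo] --> \int[mu']_x (F x * h (a x)).
    move=> iF ma; have mF : measurable_fun setT F.
      by apply/measurable_EFinP; exact: measurable_int iF.
    apply: (@Rintegral_dominated_cvg _ _ _ _ _ _ (fun x => (M + M) * `|F x|) _ _ _ _).2.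
    + by move=> n; apply: measurable_funM => //; exact: measurableT_comp.
    + by move=> x; apply: cvgM; [exact: cvg_cst|exact: s_cvg].
    + exact: (integrableZl measurableT _ (integrable_norm iF)).
    + by move=> n x; rewrite normrM mulrC ler_wpM2r.
  have c1 := gen _ _ mu1 F1 a1 iF1 ma1; have c2 := gen _ _ mu2 F2 a2 iF2 ma2.
  by apply: (cvg_unique _ c1); move: c2; rewrite -(funext eqs).
have split d' (T' : measurableType d') (mu' : {measure set T' -> \bar R})
      (F : T' -> R) (a : T' -> T0) : mu'.-integrable setT (EFin \o F) ->
      measurable_fun setT a ->
      \int[mu']_x (F x * h (a x)) = \int[mu']_x (F x * g (a x)) +
        M * \int[mu']_x F x.
  move=> iF ma; rewrite -RintegralZl//.
  rewrite -RintegralD//.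
  - by apply: eq_Rintegral => x _; rewrite /h mulrDr [M * _]mulrC.
  - apply: (@integrable_mul_bounded _ _ _ _ _ _ M iF) => //.
    exact: measurableT_comp.
  - exact: (integrableZl measurableT _ iF).
have := eqB setT measurableT.
have mulT x : F1 x * \1_setT (a1 x) = F1 x by rewrite indicE in_setT mulr1.
have mulT' x : F2 x * \1_setT (a2 x) = F2 x by rewrite indicE in_setT mulr1.
under eq_Rintegral do rewrite mulT.
under [in X in _ = X -> _]eq_Rintegral do rewrite mulT'.
by move=> eqT; apply/(addIr (M * \int[mu1]_x F1 x)); rewrite -split// eqT -split.
Qed.

End signed_measure.

(** The sets of integral zero form a Dynkin system: the vanishing total integral gives complements,
    countable additivity gives disjoint unions. *)
Lemma Rintegral_dynkin d0 (T0 : measurableType d0) d (T : measurableType d)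
    (R : realType) (mu : {measure set T -> \bar R}) (F : T -> R) (a : T -> T0)
    (G : set (set T0)) :
  mu.-integrable setT (EFin \o F) -> measurable_fun setT a ->
  G `<=` measurable -> setI_closed G -> \int[mu]_x F x = 0 ->
  (forall B, G B -> \int[mu]_(x in a @^-1` B) F x = 0) ->
  forall B, <<s G >> B -> \int[mu]_(x in a @^-1` B) F x = 0.
Proof.
move=> iF ma Gm GI F0 FG.
have iFS A : measurable A -> mu.-integrable A (EFin \o F).
  by move=> mA; apply: integrableS iF.
have mpre B : measurable B -> measurable (a @^-1` B).
  by move=> mB; rewrite -[X in measurable X]setTI; exact: ma.
suff: <<s G >> `<=` [set B | measurable B /\ \int[mu]_(x in a @^-1` B) F x = 0].
  by move=> sub B /sub[].
rewrite -setI_closed_g_dynkin_g_sigma_algebra//.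
apply: smallest_sub; last by move=> B GB; split; [exact: Gm|exact: FG].
split.
- by split; [exact: measurableT|rewrite preimage_setT].
- move=> B [mB B0]; split; first exact: measurableC.
  rewrite preimage_setC; move: F0.
  rewrite -(setUv (a @^-1` B)) Rintegral_setU//.
  + by rewrite B0 add0r.
  + exact: mpre.
  + by apply: measurableC; exact: mpre.
  + by rewrite setUv.
  + by apply/disj_setPS; rewrite setICr.
- move=> A tA mA; split; first by apply: bigcup_measurable => n _; have [] := mA n.
  rewrite preimage_bigcup /Rintegral integral_bigcup//.
  + rewrite eseries0// => n _ _; have [mAn An0] := mA n.
    rewrite -[LHS]fineK; last by apply: integrable_fin_num; [exact: mpre|exact/iFS/mpre].
    by congr EFin.
  + apply/trivIsetP => i j _ _ ij; rewrite -preimage_setI.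
    by move/trivIsetP : tA => ->//; rewrite preimage_set0.
  + by move=> n; apply: mpre; have [] := mA n.
  + by apply: iFS; apply: bigcup_measurable => n _; apply: mpre; have [] := mA n.
Qed.

(** * Polynomial approximation of a step function *)

Section soft_threshold.
Context {R : realType}.

(* A polynomial in u approximating the indicator of u < 1/2 on [0, 1]; the
   factor N in the exponent takes care of the boundary point u = 1/2. *)
Definition soft_threshold (N : nat) (u : R) : R :=
  (1 - u ^+ N) ^+ (N * 2 ^ N).

Lemma bernoulli_ineq (x : R) n : - 1 <= x -> 1 + n%:R * x <= (1 + x) ^+ n.
Proof.
move=> x1; elim: n => [|n ih]; first by rewrite mul0r addr0 expr0.
rewrite exprS; apply: (@le_trans _ _ ((1 + x) * (1 + n%:R * x))); last first.
  by apply: ler_wpM2l => //; lra.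
rewrite -natr1; have : 0 <= n%:R * x ^+ 2 by rewrite mulr_ge0// sqr_ge0.
nra.
Qed.

(** With y = w^2, the bound n w^n (1 - w) <= 1 - w^n <= 1 uses up one factor w^n, and the other one
    still tends to 0. *)
Lemma cvg_natM_expr (y : R) : 0 <= y < 1 -> n%:R * y ^+ n @[n --> \oo] --> (0 : R).
Proof.
move=> /andP[y0 y1]; set w := Num.sqrt y.
have w0 : 0 <= w by exact: sqrtr_ge0.
have w1 : w < 1 by rewrite -sqrtr1 ltr_sqrt.
have yw : y = w ^+ 2 by rewrite sqr_sqrtr.
have wn n : 0 <= w ^+ n <= 1 by rewrite exprn_ge0// exprn_ile1// ltW.
have key n : n%:R * w ^+ n * (1 - w) <= 1 - w ^+ n.
  elim: n => [|n ih]; first by rewrite mul0r mul0r expr0 subrr.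
  rewrite -natr1 exprS; have /andP[a b] := wn n.
  have ih' := ler_wpM2l w0 ih.
  have : 0 <= (1 - w) * (1 - w * w ^+ n).
    rewrite mulr_ge0//; first lra.
    by have := wn n.+1; rewrite exprS => /andP[]; lra.
  nra.
apply: (@squeeze_cvgr _ _ _ _ (fun=> 0) (fun n => (1 - w)^-1 * w ^+ n)).
- apply: nearW => n; rewrite mulr_ge0//=; last by rewrite exprn_ge0.
  rewrite [leRHS]mulrC ler_pdivlMr ?subr_gt0//.
  rewrite yw -exprM mulnC exprM expr2; have /andP[a b] := wn n.
  have := ler_wpM2r a (key n); nra.
- exact: cvg_cst.
- rewrite -[X in _ --> X](mulr0 (1 - w)^-1); apply: cvgM; first exact: cvg_cst.
  by apply: cvg_expr; rewrite ger0_norm.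
Qed.

Lemma soft_threshold_ge0 N (u : R) : 0 <= u <= 1 -> 0 <= soft_threshold N u.
Proof.
by move=> /andP[u0 u1]; rewrite exprn_ge0// subr_ge0 exprn_ile1.
Qed.

Lemma soft_threshold_le1 N (u : R) : 0 <= u <= 1 -> soft_threshold N u <= 1.
Proof.
move=> /andP[u0 u1]; rewrite exprn_ile1//; first by rewrite subr_ge0 exprn_ile1.
by rewrite gerBl exprn_ge0.
Qed.

(** Put x = u^N and M = N 2^N, so that M x = N (2u)^N. If u < 1/2 this tends to 0, and Bernoulli
    gives (1 - x)^M >= 1 - M x. If u >= 1/2 it is at least N, and (1 - x)^M (1 + x)^M <= 1 gives (1
    - x)^M <= 1 / (1 + M x) <= 1 / (N + 1). *)
Lemma cvg_soft_threshold (u : R) : 0 <= u <= 1 ->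
  soft_threshold N u @[N --> \oo] --> (if u < 2^-1 then 1 else 0 : R).
Proof.
move=> u01; have /andP[u0 u1] := u01.
have st_ge0 N := soft_threshold_ge0 N u01.
have st_le1 N := soft_threshold_le1 N u01.
have MuE N : (N * 2 ^ N)%:R * u ^+ N = N%:R * (2 * u) ^+ N.
  by rewrite natrM natrX exprMn mulrA.
have [u2|u2] := ltrP u 2^-1.
- apply: (@squeeze_cvgr _ _ _ _ (fun N => 1 - N%:R * (2 * u) ^+ N) (fun=> 1)).
  + apply: nearW => N; rewrite st_le1 andbT -MuE -mulrN.
    apply: bernoulli_ineq; rewrite lerN2; exact: exprn_ile1.
  + rewrite -[X in _ --> X]subr0; apply: cvgB; first exact: cvg_cst.
    by apply: cvg_natM_expr; rewrite mulr_ge0//=; lra.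
  + exact: cvg_cst.
- apply: (@squeeze_cvgr _ _ _ _ (fun=> 0) (fun N => N.+1%:R^-1)).
  + apply: nearW => N; rewrite st_ge0/=.
    set M := (N * 2 ^ N)%N; set x := u ^+ N.
    have x0 : 0 <= x by exact: exprn_ge0.
    have x1 : x <= 1 by exact: exprn_ile1.
    have b := @bernoulli_ineq x M ltac:(lra).
    have NM : N%:R <= M%:R * x.
      rewrite MuE ler_peMr// exprn_ege1//; lra.
    rewrite -[leRHS]mul1r ler_pdivlMr//.
    apply: (@le_trans _ _ (soft_threshold N u * (1 + x) ^+ M)).
      apply: ler_wpM2l; first exact: st_ge0.
      by apply: le_trans b; rewrite -natr1; lra.
    rewrite /soft_threshold -/M -/x -exprMn exprn_ile1//; nra.
  + exact: cvg_cst.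
  + exact: cvg_harmonic.
Qed.

End soft_threshold.

(** * Uniqueness of Fourier transforms *)

Lemma cosM (R : realType) (x y : R) : cos x * cos y = 2^-1 * cos (x + y) + 2^-1 * cos (x - y).
Proof. by rewrite cosD cosB; field. Qed.

Section fourier_uniqueness.
Context d (T : measurableType d) (R : realType) (mu : {measure set T -> \bar R}).
Variables (F z : T -> R).
Hypotheses (iF : mu.-integrable setT (EFin \o F)) (mz : measurable_fun setT z).

(* The functions g for which the measure (F mu) o z^-1 weighted by g has zero
   Fourier transform; they form an algebra closed under bounded limits. *)
Let killed (g : R -> R) := [/\ measurable_fun setT g,
  exists M, forall x, `|g x| <= M &
  forall s c, \int[mu]_t (F t * (g (z t) * cos (s * z t + c))) = 0].

Let measurable_cos_affine (s c : R) : measurable_fun setT (fun x : R => cos (s * x + c)).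
Proof.
apply: measurableT_comp; first by apply: continuous_measurable_fun; exact: continuous_cos.
by apply: measurable_funD => //; exact: measurable_funM.
Qed.

Let integrable_killed g s c : killed g ->
  mu.-integrable setT (EFin \o (fun t => F t * (g (z t) * cos (s * z t + c)))).
Proof.
move=> [mg [M gM] _]; apply: (integrable_mul_bounded (M := M) iF).
  apply: measurable_funM; first exact: measurableT_comp.
  exact: (measurableT_comp (measurable_cos_affine s c)).
move=> t; rewrite normrM -[leRHS]mulr1.
by apply: ler_pM => //; exact: cos_max.
Qed.

Let killed_lin g h a b : killed g -> killed h -> killed (fun x => a * g x + b * h x).
Proof.
move=> kg kh; have [mg [M gM] g0] := kg; have [mh [N hN] h0] := kh; split.
- by apply: measurable_funD; exact: measurable_funM.
- exists (`|a| * M + `|b| * N) => x.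
  by rewrite (le_trans (ler_normD _ _))// !normrM lerD// ler_wpM2l.
- move=> s c.
  under eq_Rintegral => t _.
    rewrite (_ : _ * _ = a * (F t * (g (z t) * cos (s * z t + c))) +
      b * (F t * (h (z t) * cos (s * z t + c)))); last by ring.
    over.
  rewrite RintegralD//.
  + rewrite !RintegralZl//; [by rewrite g0 h0 !mulr0 addr0|exact: integrable_killed..].
  + exact: (integrableZl measurableT _ (integrable_killed s c kg)).
  + exact: (integrableZl measurableT _ (integrable_killed s c kh)).
Qed.

(** By [cosM] the product of the two cosines is a half-sum of cosines of frequencies r + s and r - s
    with new phases, at which the transform of g vanishes too. *)
Let killed_cos g r e : killed g -> killed (fun x => cos (r * x + e) * g x).
Proof.
move=> kg; have [mg [M gM] g0] := kg; split.
- by apply: measurable_funM.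
- exists M => x; rewrite normrM -[leRHS]mul1r.
  by apply: ler_pM => //; exact: cos_max.
- move=> s c.
  have E t : F t * (cos (r * z t + e) * g (z t) * cos (s * z t + c)) =
      2^-1 * (F t * (g (z t) * cos ((r + s) * z t + (e + c)))) +
      2^-1 * (F t * (g (z t) * cos ((r - s) * z t + (e - c)))).
    have <- : r * z t + e + (s * z t + c) = (r + s) * z t + (e + c) by ring.
    have <- : r * z t + e - (s * z t + c) = (r - s) * z t + (e - c) by ring.
    rewrite mulrAC cosM; ring.
  under eq_Rintegral do rewrite E.
  rewrite RintegralD//.
  + rewrite !RintegralZl//; [by rewrite !g0 !mulr0 addr0|exact: integrable_killed..].
  + exact: (integrableZl measurableT _ (integrable_killed _ _ kg)).
  + exact: (integrableZl measurableT _ (integrable_killed _ _ kg)).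
Qed.

Let killed_lim (g_ : nat -> R -> R) g : (forall n, killed (g_ n)) ->
  (forall n x, `|g_ n x| <= 1) -> (forall x, g_ n x @[n --> \oo] --> g x) ->
  killed g.
Proof.
move=> kg g1 cg; split.
- by apply: (measurable_fun_cvg (h := g_)) => [n|x _]; [have [] := kg n|exact: cg].
- exists 1 => x; apply: (cvgr_to_le (cvg_norm (cg x))).
  by apply: nearW => n; exact: g1.
- move=> s c; have mF : measurable_fun setT F.
    by apply/measurable_EFinP; exact: measurable_int iF.
  have [] := @Rintegral_dominated_cvg _ _ _ mu
    (fun n t => F t * (g_ n (z t) * cos (s * z t + c)))
    (fun t => F t * (g (z t) * cos (s * z t + c)))
    (fun t => `|F t|).
  + by move=> n; apply/measurable_EFinP; exact: measurable_int (integrable_killed s c (kg n)).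
  + by move=> t; apply: cvgM; [exact: cvg_cst|apply: cvgM; [exact: cg|exact: cvg_cst]].
  + exact: integrable_norm iF.
  + move=> n t; rewrite normrM ler_piMr// normrM -[leRHS]mul1r.
    by apply: ler_pM => //; exact: cos_max.
  move=> _; rewrite (_ : (fun n => _) = fun=> 0).
    by move/cvg_lim => <- //; rewrite lim_cst.
  by apply/funext => n; have [_ _] := kg n.
Qed.


(** The factor rescales the cosine to [0, 1], where [soft_threshold] operates; the threshold 1/2
    then separates the signs of the cosine. *)
Let affine r e (g : R -> R) x := (2^-1 + 2^-1 * cos (r * x + e)) * g x.

Let killed_affine r e g : killed g -> killed (affine r e g).
Proof.
move=> kg; have := killed_lin 2^-1 2^-1 kg (killed_cos r e kg).
by congr killed; apply/funext => x; rewrite /affine; ring.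
Qed.

Hypothesis F_killed : forall s c, \int[mu]_t (F t * cos (s * z t + c)) = 0.

Let killed_soft r e N :
  killed (fun x => soft_threshold N (2^-1 + 2^-1 * cos (r * x + e))).
Proof.
have k1 : killed (fun=> 1).
  split; [exact: measurable_cst|by exists 1 => x; rewrite normr1|].
  by move=> s c; under eq_Rintegral do rewrite mul1r; exact: F_killed.
have kexp g n : killed g -> killed (fun x => (2^-1 + 2^-1 * cos (r * x + e)) ^+ n * g x).
  move=> kg; elim: n => [|n ih].
    by congr killed : kg; apply/funext => x; rewrite expr0 mul1r.
  by have := killed_affine r e ih; congr killed; apply/funext => x; rewrite /affine exprS mulrA.
rewrite /soft_threshold; elim: (N * 2 ^ N)%N => [|m ih].
  by congr killed : k1; apply/funext => x; rewrite expr0.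
have := killed_lin 1 (- 1) ih (kexp _ N ih).
by congr killed; apply/funext => x; rewrite exprS; ring.
Qed.

Let killed_sign r e : killed (fun x => if cos (r * x + e) < 0 then 1 else 0).
Proof.
have u01 x : 0 <= 2^-1 + 2^-1 * cos (r * x + e) <= 1.
  by have := cos_max (r * x + e); rewrite ler_norml => /andP[? ?]; apply/andP; split; lra.
apply: (killed_lim (killed_soft r e)) => [n x|x].
  by rewrite ger0_norm ?soft_threshold_le1// soft_threshold_ge0.
have -> : (cos (r * x + e) < 0) = (2^-1 + 2^-1 * cos (r * x + e) < 2^-1).
  by apply/idP/idP; lra.
exact: cvg_soft_threshold.
Qed.

(** With frequency 1/(n+1) and this phase, the cosine is sin((x - a)/(n+1)), which has the sign of x
    - a once |x - a|/(n+1) < pi. The indicators are thus eventually constant in n, and the point x =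
    a falls on the right side because sin 0 is not negative. *)
Let killed_ray a : killed (fun x => if x < a then 1 else 0).
Proof.
apply: (killed_lim (fun n => killed_sign n.+1%:R^-1 (- (n.+1%:R^-1 * a) - pi / 2))).
  by move=> n x; case: ifP; rewrite (normr1, normr0).
move=> x; apply: cvg_near_cst.
have E n : cos (n.+1%:R^-1 * x + (- (n.+1%:R^-1 * a) - pi / 2)) = sin (n.+1%:R^-1 * (x - a)).
  rewrite -cosBpihalf; congr cos; ring.
have : n.+1%:R^-1 * (x - a) @[n --> \oo] --> (0 : R).
  rewrite -[X in _ --> X](mul0r (x - a)); apply: cvgM; last exact: cvg_cst.
  exact: cvg_harmonic.
move=> /cvgrPdist_lt /(_ pi (pi_gt0 R)); apply: filterS => n.
rewrite sub0r normrN E ltr_norml => /andP[h1 h2].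
have n0 : 0 < n.+1%:R^-1 :> R by rewrite invr_gt0.
have [xa|xa] := ltrP x a.
- by rewrite -oppr_gt0 -sinN sin_gt0_pi// oppr_gt0 pmulr_rlt0// subr_lt0 xa/= ltrNl.
- rewrite ifF// ltNge; apply/negbF; apply: sin_ge0_pi.
  by rewrite (ltW h2) andbT mulr_ge0 ?subr_ge0 ?(ltW n0).
Qed.

(** Left rays are stable under intersection and generate the Borel sets. The integral over the
    preimage of a ray is the transform of [killed_ray] at frequency and phase 0. *)
Lemma fourier_uniqueness B : measurable B -> \int[mu]_(x in z @^-1` B) F x = 0.
Proof.
have mE : (measurable : set (set R)) = <<s @RGenInftyO.G R >> by exact: RGenInftyO.measurableE.
move=> mB; apply: (@Rintegral_dynkin _ R _ _ _ mu F z (@RGenInftyO.G R)) => //.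
- by move=> _ [a ->]; exact: measurable_itv.
- move=> _ _ [a ->] [b ->]; exists (Num.min a b).
  by apply/seteqP; split => x /=; rewrite !in_itv/= lt_min => /andP.
- by have := F_killed 0 0; under eq_Rintegral do rewrite mul0r addr0 cos0 mulr1.
- move=> _ [a ->]; rewrite Rintegral_mkcond.
  have [_ _ /(_ 0 0)] := killed_ray a.
  under eq_Rintegral do rewrite mul0r addr0 cos0 mulr1.
  move=> h; rewrite -[RHS]h; apply: eq_Rintegral => t _.
  rewrite patch_indic/= indicE; case: ifPn => ta.
    by rewrite mem_set//= in_itv.
  by rewrite memNset//= in_itv/=; exact/negP.
- by rewrite -mE.
Qed.

End fourier_uniqueness.

Section fourier_uniqueness_vector.
Context d (T : measurableType d) (R : realType) (mu : {measure set T -> \bar R}).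
Variables (n : nat) (Z : 'I_n -> T -> R).
Hypothesis mZ : forall i, measurable_fun setT (Z i).

(** In contrast with the scalar case, the density F varies here: indicators of the coordinates are
    multiplied into it. *)
Let killed (F : T -> R) := mu.-integrable setT (EFin \o F) /\
  forall (s : 'I_n -> R) c, \int[mu]_t (F t * cos (\sum_i s i * Z i t + c)) = 0.

Let measurable_form (s : 'I_n -> R) c :
  measurable_fun setT (fun t => cos (\sum_i s i * Z i t + c)).
Proof.
apply: measurableT_comp.
  by apply: continuous_measurable_fun; exact: continuous_cos.
apply: measurable_funD => //; apply: measurable_sum => i.
exact: measurable_funM.
Qed.

(** Scalar uniqueness is applied to the density F cos(s.Z + c) and the single variable [Z i]:
    multiplying by cos(r Z_i + e) merely moves s by r or -r in the direction i. *)
Let killed_step F i B : measurable B -> killed F ->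
  killed (fun t => F t * \1_B (Z i t)).
Proof.
move=> mB [iF F0]; split.
  apply: (@integrable_mul_bounded _ _ _ mu F (fun t => \1_B (Z i t)) 1 iF).
    by apply: measurableT_comp => //; exact: measurable_indic.
  by move=> t; rewrite indicE; case: (_ \in _); rewrite (normr0, normr1).
move=> s c; pose G t := F t * cos (\sum_i s i * Z i t + c).
have iG : mu.-integrable setT (EFin \o G).
  apply: (integrable_mul_bounded (M := 1) iF) => //.
  by move=> t; exact: cos_max.
have shift r t : \sum_j (s j + r * (j == i)%:R) * Z j t = \sum_j s j * Z j t + r * Z i t.
  under eq_bigr do rewrite mulrDl.
  rewrite big_split/=; congr (_ + _).
  rewrite (bigD1 i)//= eqxx mulr1 big1 ?addr0// => j /negbTE ->.
  by rewrite mulr0 mul0r.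
have iFc (s' : 'I_n -> R) c' :
    mu.-integrable setT (EFin \o (fun t => F t * cos (\sum_i s' i * Z i t + c'))).
  apply: (integrable_mul_bounded (M := 1) iF) => //.
  by move=> t; exact: cos_max.
have := @fourier_uniqueness _ _ _ mu G (Z i) iG (mZ i) _ B mB.
rewrite Rintegral_mkcond.
rewrite (_ : (G \_ _) = fun t => F t * \1_B (Z i t) * cos (\sum_i0 s i0 * Z i0 t + c)).
  apply=> r e; rewrite /G.
  have E t : F t * cos (\sum_i0 s i0 * Z i0 t + c) * cos (r * Z i t + e) =
      2^-1 * (F t * cos (\sum_j (s j + r * (j == i)%:R) * Z j t + (c + e))) +
      2^-1 * (F t * cos (\sum_j (s j + (- r) * (j == i)%:R) * Z j t + (c - e))).
    rewrite !shift; set S := \sum_(j < n) _.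
    have <- : S + c + (r * Z i t + e) = S + r * Z i t + (c + e) by ring.
    have <- : S + c - (r * Z i t + e) = S + - r * Z i t + (c - e) by ring.
    rewrite -mulrA cosM; ring.
  under eq_Rintegral do rewrite E.
  rewrite RintegralD//.
  - by rewrite !RintegralZl// !F0 !mulr0 addr0.
  - exact: (integrableZl measurableT _ (iFc _ _)).
  - exact: (integrableZl measurableT _ (iFc _ _)).
by rewrite patch_indic; apply/funext => t; rewrite /G /= mulrAC.
Qed.

Let killed_prod F B (r : seq 'I_n) : (forall i, measurable (B i)) -> killed F ->
  killed (fun t => F t * \prod_(i <- r) \1_(B i) (Z i t)).
Proof.
move=> mB kF; elim: r => [|i r ih].
  by congr killed : kF; apply/funext => t; rewrite big_nil mulr1.
have := killed_step i (mB i) ih; congr killed; apply/funext => t.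
by rewrite big_cons -mulrA [X in _ * X]mulrC.
Qed.

(** Iterating [killed_step] over the coordinates settles the boxes, which are stable under
    intersection and generate the sigma-algebra of Z. *)
Lemma fourier_uniqueness_vector (F : T -> R) A :
  mu.-integrable setT (EFin \o F) ->
  (forall (s : 'I_n -> R) c, \int[mu]_t (F t * cos (\sum_i s i * Z i t + c)) = 0) ->
  g_sigma_preimage Z A -> \int[mu]_(x in A) F x = 0.
Proof.
move=> iF F0 ZA.
pose G := [set A | exists2 B : 'I_n -> set R, (forall i, measurable (B i)) &
  A = [set t | forall i, B i (Z i t)]].
have GE B : [set t | forall i, B i (Z i t)] = \bigcap_i (Z i @^-1` B i).
  by apply/seteqP; split=> [t tB i _|t tB i]; exact: tB.
have Gint B : (forall i, measurable (B i)) ->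
    \int[mu]_(x in [set t | forall i, B i (Z i t)]) F x = 0.
  move=> mB; have [_ /(_ (fun=> 0) 0)] := killed_prod (index_enum 'I_n) mB (conj iF F0).
  move=> h; rewrite -[RHS]h Rintegral_mkcond patch_indic; apply: eq_Rintegral => t _.
  rewrite [X in cos (X + _)]big1 => [|i _]; last by rewrite mul0r.
  rewrite addr0 cos0 mulr1 /=; congr (_ * _).
  rewrite indicE; case: (boolP (t \in _)) => [/set_mem tB|/negP tB].
    by rewrite big1// => i _; rewrite indicE mem_set//; exact: tB.
  have /existsNP[i tBi] : ~ (forall i, B i (Z i t)) by move=> tB'; apply: tB; rewrite inE.
  by rewrite (bigD1 i)//= indicE memNset// mul0r.
apply: (@Rintegral_dynkin _ T _ _ _ mu F id G) => //.
- move=> _ [B mB ->]; rewrite GE; apply: fin_bigcap_measurable => // i _.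
  by rewrite -[X in measurable X]setTI; exact: mZ.
- move=> _ _ [B mB ->] [C mC ->]; exists (fun i => B i `&` C i).
    by move=> i; exact: measurableI.
  apply/seteqP; split => t /=; first by move=> [tB tC] i; split.
  by move=> tBC; split => i; have [] := tBC i.
- have := F0 (fun=> 0) 0; under eq_Rintegral => t _.
    rewrite [X in cos (X + _)]big1 => [|i _]; last by rewrite mul0r.
    rewrite addr0 cos0 mulr1; over.
  by [].
- by move=> _ [B mB ->]; exact: Gint.
- move: ZA; apply: smallest_sub; first exact: smallest_sigma_algebra.
  apply: (big_ind (fun U => U `<=` <<s G >>)) => //.
    by move=> U V US VS; rewrite subUset.
  move=> i _ _ [B mB <-]; apply: sub_sigma_algebra.
  exists (fun j => if j == i then B else setT).
    by move=> j; case: ifP.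
  rewrite setTI; apply/seteqP; split => t /=.
    by move=> tB j; case: ifPn => // /eqP ->.
  by move/(_ i); rewrite eqxx.
Qed.

End fourier_uniqueness_vector.

(** * Fourier transform of Gaussian laws *)

Section normal_fourier.
Context (R : realType) (s : R).
Hypothesis s0 : 0 < s.
Notation mu := (@lebesgue_measure R).

Let q (x : R) := normal_pdf 0 s x.

Let qE x : q x = normal_peak s * expR (- (x ^+ 2 / (s ^+ 2 *+ 2))).
Proof. by rewrite /q normal_pdfE ?gt_eqF// /normal_fun subr0 mulNr. Qed.

Let q0 x : 0 <= q x.
Proof. exact: normal_pdf_ge0. Qed.

Let is_derive_q (x : R) : is_derive x 1 q (- (x / s ^+ 2) * q x).
Proof.
have -> : q = (fun x => normal_peak s * expR (- (x ^+ 2 / (s ^+ 2 *+ 2)))).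
  by apply/funext => y; exact: qE.
apply: is_derive_eq.
by rewrite /GRing.scale/=; field; rewrite gt_eqF.
Qed.

Let integrable_q : mu.-integrable setT (EFin \o q).
Proof. exact: integrable_normal_pdf. Qed.

Let measurable_affine (t c : R) : measurable_fun setT (fun x : R => t * x + c).
Proof. by apply: measurable_funD => //; exact: measurable_funM. Qed.

(** The dominating function is a multiple of the normal density of standard deviation 2s. The ratio
    of the two exponentials is expR (3 x^2 / (8 s^2)), which exceeds |x| / s by expR y >= 1 + y. *)
Let integrable_xq : mu.-integrable setT (EFin \o (fun x => `|x| * q x)).
Proof.
have s2 : s * 2 != 0 by rewrite mulf_neq0// gt_eqF.
have K0 := normal_peak_gt0 s2.
pose C := s * normal_peak s / normal_peak (s * 2).
apply: (le_integrable measurableT _ _ (integrableZl measurableT C (integrable_normal_pdf 0 (s * 2)))).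
  apply/measurable_EFinP; apply: measurable_funM.
    by apply: continuous_measurable_fun; exact: norm_continuous.
  exact: measurable_normal_pdf.
move=> x _; rewrite -EFinM !abse_EFin lee_fin.
rewrite (ger0_norm (mulr_ge0 (normr_ge0 _) (q0 _))).
apply: le_trans (ler_norm _).
rewrite normal_pdfE// qE /normal_fun subr0 mulNr /C.
rewrite [leRHS]mulrA divfK ?gt_eqF//.
rewrite mulrCA [s * _]mulrC -[leRHS]mulrA; apply: ler_wpM2l; first exact: normal_peak_ge0.
have h : `|x| <= s * expR (3 * x ^+ 2 / (8 * s ^+ 2)).
  apply: (@le_trans _ _ (s * (1 + 3 * x ^+ 2 / (8 * s ^+ 2)))); last first.
    by apply: ler_wpM2l; [exact: ltW|exact: expR_ge1Dx].
  have -> : x ^+ 2 = `|x| ^+ 2 by rewrite real_normK// num_real.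
  set y := `|x|; have -> : s * (1 + 3 * y ^+ 2 / (8 * s ^+ 2)) = (8 * s ^+ 2 + 3 * y ^+ 2) / (8 * s).
    by field; rewrite gt_eqF.
  rewrite ler_pdivlMr ?mulr_gt0//.
  have := sqr_ge0 (y - s); have := sqr_ge0 (y - 2 * s); have := sqr_ge0 s.
  have : 0 <= y by exact: normr_ge0.
  nra.
rewrite (_ : expR (- (x ^+ 2 / ((s * 2) ^+ 2 *+ 2))) =
  expR (3 * x ^+ 2 / (8 * s ^+ 2)) * expR (- (x ^+ 2 / (s ^+ 2 *+ 2)))).
  by rewrite mulrA; apply: ler_wpM2r => //; exact: expR_ge0.
by rewrite -expRD; congr expR; field; rewrite gt_eqF.
Qed.

Let measurable_q : measurable_fun setT q.
Proof. exact: measurable_normal_pdf. Qed.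

Let measurable_cosa (t c : R) : measurable_fun setT (fun x : R => cos (t * x + c)).
Proof.
apply: measurableT_comp (measurable_affine t c).
by apply: continuous_measurable_fun; exact: continuous_cos.
Qed.

Let measurable_sina (t c : R) : measurable_fun setT (fun x : R => sin (t * x + c)).
Proof.
apply: measurableT_comp (measurable_affine t c).
by apply: continuous_measurable_fun; exact: continuous_sin.
Qed.

Let integrable_qcos t c : mu.-integrable setT (EFin \o (fun x => q x * cos (t * x + c))).
Proof.
apply: (integrable_mul_bounded (M := 1) integrable_q); first exact: measurable_cosa.
by move=> x; exact: cos_max.
Qed.

Let integrable_xqsin t c : mu.-integrable setT (EFin \o (fun x => x * q x * sin (t * x + c))).
Proof.
apply: (le_integrable measurableT _ _ integrable_xq).
  apply/measurable_EFinP; apply: measurable_funM; last exact: measurable_sina.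
  exact: measurable_funM.
move=> x _; rewrite !abse_EFin lee_fin !normrM normr_id ler_piMr ?mulr_ge0//.
exact: sin_max.
Qed.

(** The sign e covers both ends of the line at once. The bound expR y >= 1 + y already gives decay
    of order 1/(n+1). *)
Let cvg_q (e : R) : `|e| = 1 -> q (e * n%:R) @[n --> \oo] --> (0 : R).
Proof.
move=> e1; have e2 : e ^+ 2 = 1 by rewrite -(real_normK (num_real e)) e1 expr1n.
apply: (@squeeze_cvgr _ _ _ _ (fun=> 0) (fun n => (normal_peak s * (s ^+ 2 *+ 2 + 1)) * n.+1%:R^-1)).
- apply: nearW => n; rewrite q0/= qE -mulrA; apply: ler_wpM2l; first exact: normal_peak_ge0.
  rewrite exprMn e2 mul1r expRN.
  rewrite ler_pdivlMr// mulrC ler_pdivrMr ?expR_gt0//.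
  set d := s ^+ 2 *+ 2; have d0 : 0 < d by rewrite /d mulrn_wgt0// exprn_gt0.
  clearbody d.
  apply: (@le_trans _ _ ((d + 1) * (1 + n%:R ^+ 2 / d))); last first.
    by apply: ler_wpM2l; [lra|exact: expR_ge1Dx].
  have -> : (d + 1) * (1 + n%:R ^+ 2 / d) = (d + 1) + n%:R ^+ 2 + n%:R ^+ 2 / d.
    by field; rewrite gt_eqF.
  have : 0 <= n%:R ^+ 2 / d by rewrite divr_ge0 ?sqr_ge0// ltW.
  have : n%:R <= n%:R ^+ 2 :> R by
    rewrite -natrX ler_nat; case: (n) => // m; rewrite expnS expn1 leq_pmulr.
  by rewrite -[n.+1%:R]natr1; lra.
- exact: cvg_cst.
- rewrite -[X in _ --> X](mulr0 (normal_peak s * (s ^+ 2 *+ 2 + 1))).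
  by apply: cvgM; [exact: cvg_cst|exact: (@cvg_harmonic R)].
Qed.

(** Integration by parts: h(x) = q(x) sin(t x + c) vanishes at both ends of the line, so the
    integral of its derivative is 0, and q' = - (x / s^2) q. *)
Let stein (t c : R) : \int[mu]_x (x * q x * sin (t * x + c)) =
  s ^+ 2 * t * \int[mu]_x (q x * cos (t * x + c)).
Proof.
pose h x := q x * sin (t * x + c).
pose h' x := - (s ^+ 2)^-1 * (x * q x * sin (t * x + c)) + t * (q x * cos (t * x + c)).
have dh (x : R) : is_derive x 1 h (h' x).
  have := is_derive_q x => dq.
  apply: is_derive_eq; rewrite /h' /GRing.scale/=; ring.
have ch' : continuous h'.
  have cq : continuous q by apply: continuous_normal_pdf; rewrite gt_eqF.
  have caff : continuous (fun x : R => t * x + c).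
    by move=> x; apply: cvgD; [apply: cvgM; [exact: cvg_cst|exact: cvg_id]|exact: cvg_cst].
  move=> x; apply: cvgD; apply: cvgM; try exact: cvg_cst.
    apply: cvgM; first by apply: cvgM; [exact: cvg_id|exact: cq].
    by apply: (cvg_comp _ sin); [exact: caff|exact: continuous_sin].
  apply: cvgM; first exact: cq.
  by apply: (cvg_comp _ cos); [exact: caff|exact: continuous_cos].
have ih' : mu.-integrable setT (EFin \o h').
  have := integrableD measurableT
    (integrableZl measurableT (- (s ^+ 2)^-1) (integrable_xqsin t c))
    (integrableZl measurableT t (integrable_qcos t c)).
  exact.
have mh' : measurable_fun setT h' by exact: continuous_measurable_fun.
suff : \int[mu]_x h' x = 0.
  rewrite /h' RintegralD//; last 2 first.
  - exact: (integrableZl measurableT _ (integrable_xqsin t c)).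
  - exact: (integrableZl measurableT _ (integrable_qcos t c)).
  rewrite !RintegralZl//.
  move=> /eqP; rewrite addr_eq0 => /eqP e.
  have s2 : s ^+ 2 != 0 by rewrite expf_neq0// gt_eqF.
  apply: (mulfI (invr_neq0 s2)); rewrite -[in RHS]mulrA mulKf//.
  by apply: oppr_inj; rewrite -e mulNr.
pose K n : set R := `[- n%:R, n%:R]%classic.
have intK n : \int[mu]_x (h' \_ (K n)) x = h n%:R - h (- n%:R).
  (* The fundamental theorem of calculus is applied on a nondegenerate interval, so n = 0 is treated
     apart. *)
  rewrite -Rintegral_mkcond; case: n => [|n].
    rewrite /K oppr0 subrr set_itv1; exact: Rintegral_set1.
  rewrite /Rintegral (@continuous_FTC2 _ h' h)//.
  + by apply: (@lt_trans _ _ 0); rewrite ?oppr_lt0.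
  + by apply: continuous_subspaceT.
  + split.
    * by move=> x _; have := dh x => ?; exact: ex_derive.
    * apply: cvg_at_right_filter; apply: differentiable_continuous.
      by apply/derivable1_diffP; have := dh (- n.+1%:R) => ?; exact: ex_derive.
    * apply: cvg_at_left_filter; apply: differentiable_continuous.
      by apply/derivable1_diffP; have := dh (n.+1%:R) => ?; exact: ex_derive.
  + by move=> x _; rewrite derive1E; have := dh x => ?; exact: derive_val.
have [||||_] := @Rintegral_dominated_cvg _ _ _ mu (fun n => h' \_ (K n)) h' (fun x => `|h' x|).
- move=> n; apply/(measurable_restrictT h' (measurable_itv _)).
  exact: measurable_funTS.
- move=> x; apply: cvg_near_cst; near=> n.
  rewrite /patch mem_set// /K/= in_itv/= -ler_norml.
  by near: n; exact: nbhs_infty_ger.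
- exact: integrable_norm.
- by move=> n x; rewrite /patch; case: ifP => // _; rewrite normr0.
rewrite (funext intK) => /cvg_lim <- //; apply/cvg_lim => //.
have hq0 e : `|e| = 1 -> h (e * n%:R) @[n --> \oo] --> (0 : R).
  move=> e1; apply/norm_cvg0P; apply: (squeeze_cvgr _ (cvg_cst 0) (cvg_q e1)).
  apply: nearW => n; rewrite normr_ge0/= normrM (ger0_norm (q0 _)) ler_piMr//.
  exact: sin_max.
rewrite -[X in _ --> X](subr0 0); apply: cvgB.
  by have := hq0 1 (normr1 _); under eq_fun do rewrite mul1r.
by have := hq0 (- 1) (normrN1 _); under eq_fun do rewrite mulN1r.
Unshelve. all: by end_near. Qed.

(** Differentiating under the integral and applying [stein], the transform phi satisfies phi' = -
    s^2 t phi. Its product with expR (t^2 s^2 / 2) is therefore constant, equal to its value cos c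
    at 0. *)
Lemma normal_fourier (t c : R) :
  \int[mu]_x (normal_pdf 0 s x * cos (t * x + c)) =
  expR (- (t ^+ 2 * s ^+ 2 / 2)) * cos c.
Proof.
pose phi t := \int[mu]_x (q x * cos (t * x + c)).
have dphi (r : R) : is_derive r 1 phi (- (s ^+ 2 * r) * phi r).
  pose f t x := q x * cos (t * x + c).
  have df (u x : R) : is_derive u 1 (f ^~ x) (- (x * q x * sin (u * x + c))).
    by apply: is_derive_eq; rewrite /GRing.scale/=; ring.
  have d1f u x : partial1of2 f u x = - (x * q x * sin (u * x + c)).
    by rewrite partial1of2E; have := df u x => ?; exact: derive_val.
  have Ir : `]r - 1, r + 1[%classic r by rewrite /= in_itv/=; apply/andP; split; lra.
  have if_ x : `]r - 1, r + 1[%classic x -> mu.-integrable setT (EFin \o f x).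
    by move=> _; exact: integrable_qcos.
  have df' x y : `]r - 1, r + 1[%classic x -> [set: R] y -> derivable (f ^~ y) x 1.
    by move=> _ _; have := df x y => ?; exact: ex_derive.
  have G0 y : 0 <= `|y| * q y by rewrite mulr_ge0.
  have Gub x y : `]r - 1, r + 1[%classic x -> [set: R] y -> `|partial1of2 f x y| <= `|y| * q y.
    move=> _ _; rewrite d1f normrN !normrM (ger0_norm (q0 _)) ler_piMr ?mulr_ge0//.
    exact: sin_max.
  apply: DeriveDef.
    exact: (derivable_under_integral measurableT Ir if_ df' G0 integrable_xq Gub).
  rewrite -derive1E (differentiation_under_integral measurableT Ir if_ df' G0 integrable_xq Gub).
  under eq_Rintegral do rewrite d1f -mulN1r.
  by rewrite RintegralZl// stein mulN1r mulNr.
pose psi t := phi t * expR (t ^+ 2 * s ^+ 2 / 2).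
have : psi t = psi 0.
  apply: is_derive_0_is_cst => x; have := dphi x => dx.
  by apply: is_derive_eq; rewrite /GRing.scale/=; field.
rewrite /psi expr0n/= !mul0r expR0 mulr1 => e.
have -> : cos c = phi 0.
  rewrite /phi; under eq_Rintegral do rewrite mul0r add0r.
  by rewrite RintegralZr// /Rintegral integral_normal_pdf mul1r.
by rewrite -e mulrCA -expRD addNr expR0 mulr1.
Qed.

End normal_fourier.

(* The Fourier transform of N(0, q), with a phase c so as to treat the real and
   the imaginary part at once. *)
Definition gauss_form d (T : measurableType d) (R : realType)
    (P : probability T R) (L : T -> R) (q : R) : Prop :=
  [/\ measurable_fun setT L, 0 <= q &
  forall t c, \int[P]_x cos (t * L x + c) = expR (- (t ^+ 2 * q / 2)) * cos c].

Section trig_bounds.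
Context {R : realType}.

Lemma le_norm_sin (x : R) : `|sin x| <= `|x|.
Proof.
have h (y : R) : 0 <= y -> `|sin y| <= y.
  move=> y0; have [|c _] := @MVT_segment _ (@sin R) (@cos R) 0 y y0 (fun z _ => is_derive_sin z).
    by apply: continuous_subspaceT; exact: continuous_sin.
  rewrite sin0 !subr0 => ->; rewrite normrM (ger0_norm y0) ler_piMl//.
  exact: cos_max.
have [x0|x0] := leP 0 x; first by rewrite (ger0_norm x0); exact: h.
by rewrite (ltr0_norm x0) -normrN -sinN h// oppr_ge0 ltW.
Qed.

(** This is the derivative of sine at 0. The left side is a bounded substitute for a whose integrals
    are computable from the Fourier transform. *)
Lemma cvg_scaled_sin (a : R) :
  n.+1%:R * sin (a / n.+1%:R) @[n --> \oo] --> a.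
Proof.
have [->|a0] := eqVneq a 0.
  under eq_fun do rewrite mul0r sin0 mulr0.
  exact: cvg_cst.
have h0 : a / n.+1%:R @[n --> \oo] --> (0 : R).
  rewrite -[X in _ --> X](mulr0 a); apply: cvgM; first exact: cvg_cst.
  exact: (@cvg_harmonic R).
have := is_derive_sin (0 : R); rewrite cos0 => -[ds dse].
have : h^-1 *: ((@sin R \o shift 0) h%:A - sin 0) @[h --> 0^'] --> 'D_1 (@sin R) 0.
  exact: ds.
rewrite dse.
move=> /cvgr_dnbhsP /(_ (fun n => a / n.+1%:R)) h1.
have {}h1 := h1 (conj (fun n => mulf_neq0 a0 (invr_neq0 (lt0r_neq0 (ltr0Sn R n)))) h0).
have : a * ((a / n.+1%:R)^-1 *: ((@sin R \o shift 0) (a / n.+1%:R)%:A - sin 0)) @[n --> \oo] --> a * 1.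
  by apply: cvgM; [exact: cvg_cst|exact: h1].
rewrite mulr1; apply: cvg_trans; apply: near_eq_cvg; apply: nearW => n /=.
rewrite sin0 subr0 addr0 /GRing.scale/= mulr1 invf_div mulrA mulrCA mulfV//.
by rewrite mulr1.
Qed.

Lemma le_norm_scaled_sin (a : R) n : `|n.+1%:R * sin (a / n.+1%:R)| <= `|a|.
Proof.
rewrite normrM (ger0_norm (ler0n _ _)) mulrC -ler_pdivlMr ?ltr0Sn//.
apply: (le_trans (le_norm_sin _)).
by rewrite normrM (ger0_norm (_ : 0 <= n.+1%:R^-1)).
Qed.

End trig_bounds.

Section gauss_form.
Context d (T : measurableType d) (R : realType) (P : probability T R).

Lemma integrable_bounded (f : T -> R) M : measurable_fun setT f ->
  (forall x, `|f x| <= M) -> P.-integrable setT (EFin \o f).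
Proof.
move=> mf fM.
have i1 : P.-integrable setT (EFin \o (fun=> 1 : R)).
  exact: finite_measure_integrable_cst.
have := integrable_mul_bounded i1 mf fM.
by congr (P.-integrable _ _); apply/funext => x /=; rewrite mul1r.
Qed.

Lemma measurable_cos_comp (f : T -> R) : measurable_fun setT f ->
  measurable_fun setT (fun x => cos (f x)).
Proof.
by move=> mf; apply: measurableT_comp mf; apply: continuous_measurable_fun; exact: continuous_cos.
Qed.

Lemma measurable_sin_comp (f : T -> R) : measurable_fun setT f ->
  measurable_fun setT (fun x => sin (f x)).
Proof.
by move=> mf; apply: measurableT_comp mf; apply: continuous_measurable_fun; exact: continuous_sin.
Qed.

Lemma integrable_cos (f : T -> R) : measurable_fun setT f ->
  P.-integrable setT (EFin \o (fun x => cos (f x))).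
Proof.
move=> mf; apply: (@integrable_bounded _ 1); first exact: measurable_cos_comp.
by move=> x; exact: cos_max.
Qed.

Lemma Rintegral_cst_prob (r : R) : \int[P]_x r = r.
Proof.
rewrite Rintegral_cst//.
have -> : fine (P [set: T]) = 1 by rewrite probability_setT.
by rewrite mulr1.
Qed.

Lemma Rintegral_indic_comp (L : T -> R) B : measurable_fun setT L -> measurable B ->
  \int[P]_x \1_B (L x) = fine (P (L @^-1` B)).
Proof.
move=> mL mB; rewrite /Rintegral.
rewrite -[X in _ = fine (P X)]setIT -integral_indic//.
by rewrite -[X in measurable X]setTI; exact: mL.
Qed.

(** Both cases are instances of [Rintegral_transfer]: for q = 0 the law of L is that of the constant
    0 under P, otherwise it is that of the identity under Lebesgue measure weighted by the
    density. *)
Lemma gauss_form_normal_law (L : T -> R) (q : R) : measurable_fun setT L -> 0 <= q ->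
  (forall A, measurable A -> P (L @^-1` A) = normal_law 0 q A) -> gauss_form P L q.
Proof.
move=> mL q_ge0 Llaw; split=> // t c.
have i1 : P.-integrable setT (EFin \o (fun=> 1 : R)).
  exact: finite_measure_integrable_cst.
have mcos : measurable_fun setT (fun y : R => cos (t * y + c)).
  apply: measurableT_comp; first by apply: continuous_measurable_fun; exact: continuous_cos.
  by apply: measurable_funD => //; exact: measurable_funM.
have [q0|q0] := eqVneq q 0.
- have := @Rintegral_transfer _ _ _ _ _ _ _ P P (fun=> 1) (fun=> 1) L (fun=> 0 : R)
     i1 i1 mL (measurable_cst _) _ (fun y => cos (t * y + c)) 1 mcos (fun _ => cos_max _).
  move=> tr; transitivity (\int[P]_x (1 * cos (t * 0 + c))).
    rewrite -tr => [|B mB]; first by apply: eq_Rintegral => x _; rewrite mul1r.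
    under eq_Rintegral do rewrite mul1r.
    under [RHS]eq_Rintegral do rewrite mul1r.
    by rewrite Rintegral_indic_comp// Rintegral_cst_prob Llaw// /normal_law q0 eqxx.
  by rewrite Rintegral_cst_prob q0 !mulr0 mul0r oppr0 expR0 add0r.
- have s0 : 0 < Num.sqrt q by rewrite sqrtr_gt0 lt_neqAle eq_sym q0.
  have := @Rintegral_transfer _ _ _ _ _ _ _ P lebesgue_measure (fun=> 1)
    (normal_pdf 0 (Num.sqrt q)) L id i1 (integrable_normal_pdf _ _) mL
    (@measurable_id _ _ _) _ (fun y => cos (t * y + c)) 1 mcos (fun _ => cos_max _).
  rewrite normal_fourier// sqr_sqrtr// => <- => [|B mB].
    by apply: eq_Rintegral => x _; rewrite mul1r.
  under eq_Rintegral do rewrite mul1r.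
  rewrite Rintegral_indic_comp// Llaw// /normal_law (negbTE q0) /normal_prob.
  by rewrite -[LHS]/(Rintegral _ _ _) Rintegral_mkcond patch_indic.
Qed.

End gauss_form.

(** * Sums of independent Gaussian forms *)

Section gauss_form_sum.
Context d (T : measurableType d) (R : realType) (P : probability T R).
Context (I : choiceType) (F : I -> set (set T)).
Hypothesis Fm : forall i, F i `<=` measurable.
Hypothesis indep : mutually_independent P F.
Variables (L : I -> T -> R) (q : I -> R).
Hypothesis LF : forall i B, measurable B -> F i (L i @^-1` B).
Hypothesis Lq : forall i, gauss_form P (L i) (q i).

Let measurable_sumL (r : seq I) t c :
  measurable_fun setT (fun x => t * (\sum_(i <- r) L i x) + c).
Proof.
apply: measurable_funD => //; apply: measurable_funM => //.
by apply: measurable_sum => i; have [] := Lq i.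
Qed.

(* Induction on r: one more summand of the form uses the hypothesis with one
   more event, {L i in B}, among those of J. *)
Let gauss_form_events (r : seq I) : uniq r ->
  forall (J : {fset I}) (A : I -> set T), (forall i, i \in J -> F i (A i)) ->
  (forall i, i \in r -> i \notin J) -> forall t c,
  \int[P]_x (cos (t * (\sum_(i <- r) L i x) + c) *
             \1_(\bigcap_(i in [set` J]) A i) x) =
  expR (- (t ^+ 2 * (\sum_(i <- r) q i) / 2)) * cos c *
    fine (P (\bigcap_(i in [set` J]) A i)).
Proof.
have mD (J : {fset I}) (A : I -> set T) : (forall i, i \in J -> F i (A i)) ->
    measurable (\bigcap_(i in [set` J]) A i).
  by move=> FA; apply: fin_bigcap_measurable => // i iJ; exact/Fm/FA.
have i1 B : measurable B -> P.-integrable setT (EFin \o (\1_B : T -> R)).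
  by move=> mB; apply: integrable_indic.
elim: r => [_ J A FA _ t c|i r ih /= /andP[ir ur] J A FA rJ t c].
  under eq_Rintegral do rewrite big_nil mulr0 add0r.
  rewrite RintegralZl//; last exact/i1/mD.
  rewrite big_nil mulr0 mul0r oppr0 expR0 mul1r.
  by rewrite /Rintegral integral_indic ?setIT//; exact: mD.
set D := \bigcap_(i in [set` J]) A i.
have mDD : measurable D by exact: mD.
have [mLi _ Li] := Lq i.
have iJ : i \notin J by apply: rJ; rewrite mem_head.
set K := expR (- (t ^+ 2 * (\sum_(i <- r) q i) / 2)).
pose S x := t * (\sum_(i <- r) L i x).
have mS c' : measurable_fun setT (fun x => S x + c') by exact: measurable_sumL.
have iF c' : P.-integrable setT (EFin \o (fun x => cos (S x + c') * \1_D x)).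
  apply: (integrable_mul_bounded (M := 1) (integrable_cos P (mS c'))).
    exact: measurable_indic.
  by move=> x; rewrite indicE; case: (_ \in _); rewrite (normr0, normr1).
have icst (z : R) : P.-integrable setT (EFin \o (fun=> z)).
  exact: finite_measure_integrable_cst.
(* Expectation factors over g(L i). For g the indicator of B this is the induction hypothesis with
   the event {L i in B} added to the family; [Rintegral_transfer] extends it to bounded measurable
   g. *)
have tr c' (g : R -> R) : measurable_fun setT g -> (forall y, `|g y| <= 1) ->
    \int[P]_x (cos (S x + c') * \1_D x * g (L i x)) =
    K * cos c' * fine (P D) * \int[P]_x g (L i x).
  move=> mg g1; rewrite -RintegralZl//; last first.
    apply: (integrable_bounded P (M := 1)) => //.
    exact: measurableT_comp.
  apply: (@Rintegral_transfer _ _ _ _ _ _ _ P P _ (fun=> K * cos c' * fine (P D))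
    (L i) (L i) (iF c') _ mLi mLi _ g 1 mg g1) => // B mB.
  rewrite RintegralZl//; last first.
    apply: (integrable_bounded P (M := 1)) => //.
      by apply: measurableT_comp mLi; exact: measurable_indic.
    by move=> x; rewrite indicE; case: (_ \in _); rewrite (normr0, normr1).
  rewrite Rintegral_indic_comp//.
  pose J' := (i |` J)%fset.
  pose A' j := if j == i then L i @^-1` B else A j.
  have A'J : \bigcap_(j in [set` J]) A' j = D.
    apply: eq_bigcapr => j /= jJ; rewrite /A'; case: eqP => // ji.
    by move: iJ; rewrite -ji jJ.
  have A'i : A' i = L i @^-1` B by rewrite /A' eqxx.
  have FA' j : j \in J' -> F j (A' j).
    rewrite !inE /A'; case: eqP => [-> _|_ /= /FA//]; exact: LF.
  have DE : \bigcap_(j in [set` J']) A' j = L i @^-1` B `&` D.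
    rewrite -A'J -A'i; apply/seteqP; split => [x xJ|x [xi xJ] j].
      by split=> [|j /= jJ]; apply: xJ => /=; rewrite !inE ?eqxx// jJ orbT.
    by rewrite /= !inE => /orP[/eqP ->//|jJ]; exact: xJ.
  have PDE : P (\bigcap_(j in [set` J']) A' j) = (P (L i @^-1` B) * P D)%E.
    rewrite (indep FA') big_fsetU1//= A'i; congr (_ * _)%E.
    rewrite -A'J (indep (J := J) (A := A'))// => j jJ.
    by apply: FA'; rewrite !inE jJ orbT.
  have := ih ur J' A' FA' _ t c'; rewrite PDE DE.
  have mLB : measurable (L i @^-1` B) by exact/Fm/LF.
  rewrite -/K fineM; [|by apply: fin_num_measure..].
  move=> e; rewrite -[RHS]mulrA [fine (P D) * _]mulrC -e.
    by apply: eq_Rintegral => x _; rewrite indicI/= -mulrA [\1_D x * _]mulrC.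
  move=> j jr; rewrite !inE negb_or rJ ?inE ?jr ?orbT// andbT.
  by apply: contraNneq ir => <-.
(* The addition formula separates L i from the rest. A sine of the rest is a cosine with phase
   shifted by pi/2, so [tr] applies to both terms; the second one vanishes since the expectation of
   sin(t L i) is 0. *)
under eq_Rintegral => x _.
  rewrite big_cons mulrDr (_ : _ + _ + c = S x + c + t * L i x); last by rewrite /S; ring.
  rewrite cosD mulrBl -mulNr.
  rewrite (_ : - (sin _ * _) = cos (S x + (c + pi / 2)) * sin (t * L i x)); last first.
    by rewrite addrA cosDpihalf; ring.
  rewrite mulrAC [X in _ + X]mulrAC.
  over.
have mtL : measurable_fun setT (fun x => t * L i x) by exact: measurable_funM.
have mtid : measurable_fun setT (fun y : R => t * y) by exact: measurable_funM.
rewrite RintegralD//; last 2 first.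
- apply: (integrable_mul_bounded (M := 1) (iF c)); first exact: measurable_cos_comp.
  by move=> x; exact: cos_max.
- apply: (integrable_mul_bounded (M := 1) (iF (c + pi / 2))); first exact: measurable_sin_comp.
  by move=> x; exact: sin_max.
rewrite (tr c (fun y => cos (t * y))); last 2 first.
- exact: measurable_cos_comp.
- by move=> y; exact: cos_max.
rewrite (tr (c + pi / 2) (fun y => sin (t * y))); last 2 first.
- exact: measurable_sin_comp.
- by move=> y; exact: sin_max.
have := Li t 0; under eq_Rintegral do rewrite addr0.
rewrite cos0 mulr1 => ->.
have := Li t (- (pi / 2)); under eq_Rintegral do rewrite cosBpihalf.
rewrite cosN cos_pihalf mulr0 => ->.
rewrite mulr0 addr0 big_cons mulrDr mulrDl opprD expRD /K; ring.
Qed.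

Lemma gauss_form_sum (r : seq I) : uniq r ->
  gauss_form P (fun x => \sum_(i <- r) L i x) (\sum_(i <- r) q i).
Proof.
move=> ur; split.
- by apply: measurable_sum => i; have [] := Lq i.
- by apply: sumr_ge0 => i _; have [] := Lq i.
- move=> t c; have := gauss_form_events ur (J := fset0) (A := fun=> setT) _ _ t c.
  rewrite set_fset0 bigcap_set0 probability_setT mulr1 => <-//.
  by apply: eq_Rintegral => x _; rewrite indicE in_setT mulr1.
Qed.

End gauss_form_sum.

(** * Moments and decoupling read off Fourier transforms *)

Section gauss_form_moments.
Context d (T : measurableType d) (R : realType) (P : probability T R).

Let measurable_scaled_sin (f : T -> R) n : measurable_fun setT f ->
  measurable_fun setT (fun x => n.+1%:R * sin (f x / n.+1%:R)).
Proof.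
move=> mf; apply: measurable_funM => //; apply: measurable_sin_comp.
exact: measurable_funM.
Qed.

Let integral_sqr_scaled_sin L q n : gauss_form P L q ->
  \int[P]_x (n.+1%:R * sin (L x / n.+1%:R)) ^+ 2 =
  n.+1%:R ^+ 2 / 2 * (1 - expR (- (2 * q / n.+1%:R ^+ 2))).
Proof.
move=> [mL q0 Lq]; set M : R := n.+1%:R.
have M0 : M != 0 by rewrite /M pnatr_eq0.
have E x : (M * sin (L x / M)) ^+ 2 = M ^+ 2 / 2 * (1 - cos (2 / M * L x + 0)).
  rewrite addr0 (_ : 2 / M * L x = L x / M + L x / M); last by ring.
  have h : cos (L x / M) ^+ 2 = 1 - sin (L x / M) ^+ 2.
    by rewrite -(cos2Dsin2 (L x / M)) addrK.
  by rewrite cosD -!expr2 h exprMn; field.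
under eq_Rintegral do rewrite E.
have i1 : P.-integrable setT (EFin \o (fun=> 1 : R)).
  exact: finite_measure_integrable_cst.
have ic : P.-integrable setT (EFin \o (fun x => cos (2 / M * L x + 0))).
  apply: integrable_cos; apply: measurable_funD => //; exact: measurable_funM.
rewrite RintegralZl//; last exact: (integrableB measurableT i1 ic).
rewrite RintegralB// Lq cos0 mulr1 Rintegral_cst_prob.
by congr (_ * (1 - expR (- _))); field.
Qed.

(** Since 1 - expR (- y) <= y, the squares of the scaled sines have integral at most q, and Fatou
    makes L^2 integrable. L^2 then serves as the dominating function, and the value of the limit is
    found by squeezing. *)
Lemma gauss_form_sqr L q : gauss_form P L q ->
  P.-integrable setT (EFin \o (fun x => L x ^+ 2)) /\ \int[P]_x (L x ^+ 2) = q.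
Proof.
move=> Lq; have [mL q0 _] := Lq.
pose f n x := (n.+1%:R * sin (L x / n.+1%:R)) ^+ 2.
have fcvg x : f n x @[n --> \oo] --> L x ^+ 2.
  rewrite /f expr2; under eq_fun do rewrite expr2.
  by apply: cvgM; exact: cvg_scaled_sin.
have fL n x : f n x <= L x ^+ 2.
  by rewrite -[leLHS]ger0_norm ?sqr_ge0// normrX -[leRHS]real_normK ?num_real//
    lerXn2r// ?nnegrE ?le_norm_scaled_sin.
have mf n : measurable_fun setT (f n).
  by apply: measurable_funX; exact: measurable_scaled_sin.
have y0 n : 0 <= 2 * q / n.+1%:R ^+ 2 by rewrite divr_ge0 ?sqr_ge0// mulr_ge0.
have fub n : \int[P]_x f n x <= q.
  rewrite (integral_sqr_scaled_sin n Lq); set M : R := n.+1%:R.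
  have M0 : M != 0 by rewrite /M pnatr_eq0.
  rewrite [leRHS](_ : q = M ^+ 2 / 2 * (2 * q / M ^+ 2)); last by field.
  apply: ler_wpM2l; first by rewrite divr_ge0 ?sqr_ge0.
  by rewrite lerBlDr addrC -lerBlDr; exact: expR_ge1Dx.
have ifn n : P.-integrable setT (EFin \o f n).
  apply: (integrable_bounded P (M := n.+1%:R ^+ 2)) => // x.
  rewrite /f exprMn normrM ger0_norm ?sqr_ge0// ler_piMr ?sqr_ge0//.
  by rewrite normrX expr_le1// sin_max.
have iL : P.-integrable setT (EFin \o (fun x => L x ^+ 2)).
  apply/integrableP; split; first by apply/measurable_EFinP; exact: measurable_funX.
  apply: (@le_lt_trans _ _ q%:E); last exact: ltry.
  rewrite (_ : (fun x => _) = (fun x => limn_einf (fun n => (f n x)%:E))); last first.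
    apply/funext => x; rewrite /= ger0_norm ?sqr_ge0//.
    have cE : (f n x)%:E @[n --> \oo] --> (L x ^+ 2)%:E.
      by apply: cvg_EFin; [exact: nearW|exact: fcvg].
    by rewrite (is_cvg_limn_einfE (cvgP _ cE)); apply/esym/cvg_lim.
  apply: le_trans (fatou P measurableT _ _) _.
  - by move=> n; exact/measurable_EFinP.
  - by move=> n x _; rewrite lee_fin sqr_ge0.
  rewrite limn_einf_lim; apply: lime_le; first exact: is_cvg_einfs.
  apply: nearW => n; apply: ereal_inf_le; exists (\int[P]_x (f n x)%:E)%E.
    by exists n => /=.
  rewrite -[leLHS]fineK ?lee_fin ?fub//.
  by apply: integrable_fin_num => //; exact: ifn.
split=> //.
have [||||_] := @Rintegral_dominated_cvg _ _ _ P f (fun x => L x ^+ 2) (fun x => L x ^+ 2) => //.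
  by move=> n x; rewrite ger0_norm ?sqr_ge0.
move=> /cvg_lim <- //; apply/cvg_lim => //.
(* From expR (- y) <= 1 / (1 + y) the integral is at least q / (1 + y), with y = 2q/(n+1)^2 <=
   2q/(n+1). *)
have lo n : q / (1 + 2 * q * n.+1%:R^-1) <= \int[P]_x f n x.
  rewrite (integral_sqr_scaled_sin n Lq); set M : R := n.+1%:R.
  have M1 : 1 <= M by rewrite /M ler1n.
  have M0 : M != 0 by rewrite gt_eqF// (lt_le_trans _ M1).
  set y := 2 * q / M ^+ 2.
  have yge0 : 0 <= y := y0 n.
  have eqy : q = M ^+ 2 / 2 * y by rewrite /y; field.
  have e1 : expR (- y) <= (1 + y)^-1.
    by rewrite expRN lef_pV2 ?posrE ?expR_gt0 ?expR_ge1Dx//; lra.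
  apply: (@le_trans _ _ (q / (1 + y))).
    apply: ler_wpM2l => //; rewrite lef_pV2 ?posrE; [| |lra].
      rewrite lerD2l /y; apply: ler_wpM2l; first by rewrite mulr_ge0.
      by rewrite lef_pV2 ?posrE ?exprn_gt0 ?(lt_le_trans _ M1)// ler_eXnr.
    by apply: ltr_pwDl => //; rewrite !mulr_ge0// invr_ge0 (le_trans _ M1).
  rewrite {1}eqy -mulrA; apply: ler_wpM2l; first by rewrite divr_ge0 ?sqr_ge0.
  have -> : y / (1 + y) = 1 - (1 + y)^-1 by field; lra.
  by rewrite lerD2l lerN2.
apply: (squeeze_cvgr _ _ (cvg_cst q)).
- by apply: nearW => n; apply/andP; split; [exact: lo|exact: fub].
- rewrite -[X in _ --> X]divr1; apply: cvgM; first exact: cvg_cst.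
  apply: cvgV; first exact: oner_neq0.
  rewrite -[X in _ --> X]addr0; apply: cvgD; first exact: cvg_cst.
  rewrite -(mulr0 (2 * q)); apply: cvgM; first exact: cvg_cst.
  exact: (@cvg_harmonic R).
Qed.

Lemma gauss_form_integrable L q : gauss_form P L q ->
  P.-integrable setT (EFin \o L).
Proof.
move=> Lq; have [mL q0 _] := Lq; have [iL _] := gauss_form_sqr Lq.
have i1 : P.-integrable setT (EFin \o (fun=> 1 : R)).
  exact: finite_measure_integrable_cst.
apply: (le_integrable measurableT _ _ (integrableD measurableT i1 iL)).
  exact/measurable_EFinP.
move=> x _ /=; rewrite lee_fin [leRHS]ger0_norm ?addr_ge0 ?sqr_ge0//.
rewrite -[L x ^+ 2]real_normK ?num_real//.
by have := normr_ge0 (L x); have := sqr_ge0 (`|L x| - 1); nra.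
Qed.

(* Differentiate E[cos(t Y + A + c)] at t = 0. *)
Lemma gauss_form_decoupled (Y A : T -> R) (qY qA : R) : 0 <= qY ->
  P.-integrable setT (EFin \o Y) -> measurable_fun setT A ->
  (forall t, gauss_form P (fun x => t * Y x + A x) (t ^+ 2 * qY + qA)) ->
  forall c, \int[P]_x (Y x * cos (A x + c)) = 0.
Proof.
move=> qY0 iY mA h c.
have mY : measurable_fun setT Y by apply/measurable_EFinP; exact: measurable_int iY.
pose B x := A x + (c + pi / 2).
have mB : measurable_fun setT B by exact: measurable_funD.
(* With M = n+1, this is the difference quotient of - cos(B + t Y) between t = 0 and t = 2/M, in
   product form. It is dominated by |Y| and tends to Y sin B, which is Y cos(A + c) by the choice of
   phase in B. *)
pose f n x := n.+1%:R * sin (Y x / n.+1%:R) * sin (B x + Y x / n.+1%:R).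
have mf n : measurable_fun setT (f n).
  apply: measurable_funM; first exact: measurable_scaled_sin.
  apply: measurable_sin_comp; apply: measurable_funD => //; exact: measurable_funM.
have [|||] := @Rintegral_dominated_cvg _ _ _ P f (fun x => Y x * cos (A x + c))
  (fun x => `|Y x|) mf.
- move=> x; have -> : cos (A x + c) = sin (B x + 0).
    by rewrite addr0 /B addrA sinDpihalf.
  apply: cvgM; first exact: cvg_scaled_sin.
  apply: (cvg_comp _ sin); last exact: continuous_sin.
  apply: cvgD; first exact: cvg_cst.
  rewrite -(mulr0 (Y x)); apply: cvgM; first exact: cvg_cst.
  exact: (@cvg_harmonic R).
- exact: integrable_norm.
- move=> n x; rewrite normrM -[leRHS]mulr1.
  by apply: ler_pM => //; [exact: le_norm_scaled_sin|exact: sin_max].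
move=> _ /cvg_lim <- //; apply/cvg_lim => //.
have lim0 : qY * n.+1%:R^-1 @[n --> \oo] --> (0 : R).
  rewrite -(mulr0 qY); apply: cvgM; first exact: cvg_cst.
  exact: (@cvg_harmonic R).
apply/norm_cvg0P; apply: (squeeze_cvgr _ (cvg_cst 0) lim0).
apply: nearW => n; rewrite normr_ge0/=; set M : R := n.+1%:R.
have M0 : M != 0 by rewrite /M pnatr_eq0.
have E x : f n x = M / 2 * (cos (1 * (0 * Y x + A x) + (c + pi / 2)) -
     cos (1 * (2 / M * Y x + A x) + (c + pi / 2))).
  rewrite mul0r add0r !mul1r -/(B x).
  rewrite (_ : 2 / M * Y x + A x + (c + pi / 2) = (B x + Y x / M) + Y x / M); last first.
    by rewrite /B; ring.
  rewrite -[in cos (B x)](addrK (Y x / M) (B x)) cosB cosD /f -/M; by field.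
have iaff t : P.-integrable setT (EFin \o (fun x => cos (1 * (t * Y x + A x) + (c + pi / 2)))).
  apply: integrable_cos; apply: measurable_funD => //; apply: measurable_funM => //.
  by apply: measurable_funD => //; exact: measurable_funM.
rewrite (eq_Rintegral P (fun x _ => E x)).
rewrite RintegralZl//; last exact: (integrableB measurableT (iaff 0) (iaff (2 / M))).
rewrite RintegralB//; have [_ _ ->] := h 0; have [_ _ ->] := h (2 / M).
rewrite expr0n/= mul0r add0r expr1n !mul1r.
rewrite (_ : (2 / M) ^+ 2 * qY + qA = 2 * (2 * qY / M ^+ 2) + qA); last by field.
(* The variance t^2 qY + qA has no term linear in t, so the quotient is at most M/2 * y = qY/M,
   which tends to 0. *)
set y := 2 * qY / M ^+ 2.
have y0 : 0 <= y by rewrite divr_ge0 ?sqr_ge0// mulr_ge0.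
rewrite (_ : (2 * y + qA) / 2 = y + qA / 2); last by field.
rewrite opprD expRD.
have qA0 : 0 <= qA by have [_ + _] := h 0; rewrite expr0n/= mul0r add0r.
set a := expR (- (qA / 2)); set b := expR (- y); set k := cos _.
have a0 : 0 <= a <= 1.
  by rewrite expR_ge0/= -expR0 ler_expR oppr_le0 divr_ge0.
have b0 : 0 <= 1 - b <= y.
  apply/andP; split; first by rewrite subr_ge0 -expR0 ler_expR oppr_le0.
  by rewrite lerBlDr addrC -lerBlDr; exact: expR_ge1Dx.
have -> : M / 2 * (a * k - b * a * k) = M / 2 * (1 - b) * a * k by ring.
rewrite normrM -[leRHS]mulr1; apply: ler_pM => //; last exact: cos_max.
have [/andP[a1 a2] /andP[b1 b2]] := (a0, b0).
have Mp : 0 < M by rewrite /M ltr0n.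
rewrite ger0_norm; last by rewrite !mulr_ge0// divr_ge0// ltW.
have -> : qY * M^-1 = M / 2 * y * 1 by rewrite /y; field.
apply: ler_pM => //; first by rewrite mulr_ge0// divr_ge0// ltW.
by apply: ler_wpM2l => //; rewrite divr_ge0// ltW.
Qed.

End gauss_form_moments.

(** * Versions of the conditional expectation *)

Section cond_exp_versions.
Context d (T : measurableType d) (R : realType) (P : probability T R).

Lemma sigma_rv_measurable n (U : T -> 'cV[R]_n) : random_vector U ->
  sigma_rv U `<=` measurable.
Proof.
move=> mU; apply: smallest_sub; first exact: sigma_algebra_measurable.
apply: (big_ind (fun V => V `<=` measurable)) => //.
  by move=> V W mV mW; rewrite subUset.
by move=> i _ _ [B mB <-]; exact: mU.
Qed.

Lemma sigma_rv_linear n (U : T -> 'cV[R]_n) (a : 'I_n -> R) B : measurable B ->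
  sigma_rv U ((fun t => \sum_i a i * coord U i t) @^-1` B).
Proof.
move=> mB.
pose G := \big[setU/set0]_(i < n) preimage_set_system setT (coord U i) measurable.
have mU i : measurable_fun setT (coord U i : g_sigma_algebraType G -> R).
  move=> _ C mC; apply: sub_sigma_algebra.
  rewrite /G (bigD1 i)//=; left.
  by exists C.
have mf : measurable_fun setT
    ((fun t => \sum_i a i * coord U i t) : g_sigma_algebraType G -> R).
  by apply: measurable_sum => i; exact: measurable_funM.
by have := mf measurableT B mB; rewrite setTI.
Qed.

Lemma ae_eq0_of_sign_integrals (f : T -> R) :
  P.-integrable setT (EFin \o f) ->
  \int[P]_(x in [set x | 0 < f x]) f x = 0 ->
  \int[P]_(x in [set x | f x < 0]) f x = 0 ->
  \forall x \ae P, f x = 0.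
Proof.
move=> intf fp fn.
have mf : measurable_fun setT f by apply/measurable_EFinP; exact: measurable_int intf.
have mp : measurable [set x | 0 < f x].
  have := mf measurableT `]0, +oo[%classic (measurable_itv _).
  by rewrite setTI; congr measurable; apply/seteqP; split => x /=; rewrite in_itv/= andbT.
have mn : measurable [set x | f x < 0].
  have := mf measurableT `]-oo, 0[%classic (measurable_itv _).
  by rewrite setTI; congr measurable; apply/seteqP; split => x /=; rewrite in_itv.
have absE x : `|f x| = (f \_ [set x | 0 < f x]) x - (f \_ [set x | f x < 0]) x.
  have inE' (p : pred T) : (x \in [set y | p y]) = p x.
    by apply/idP/idP => [/set_mem|/mem_set].
  rewrite /patch !inE'; have [f0|f0|f0] := ltrgtP (f x) 0.
  - by rewrite sub0r ltr0_norm.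
  - by rewrite subr0 gtr0_norm.
  - by rewrite subr0 f0 normr0.
have iR A : measurable A -> P.-integrable setT (EFin \o (f \_ A)).
  move=> mA; rewrite -restrict_EFin.
  by apply/(integrable_mkcond _ mA).1; exact: integrableS intf.
have : \int[P]_x `|f x| = 0.
  rewrite (eq_Rintegral P (fun x _ => absE x)) RintegralB//; [|exact: iR..].
  by rewrite -!Rintegral_mkcond fp fn subr0.
move=> h; have : (\int[P]_(x in setT) `|(f x)%:E| = 0)%E.
  rewrite -[LHS]fineK; last exact: (integrable_fin_num measurableT (integrable_norm intf)).
  by congr EFin; exact: h.
move/(ae_eq_integral_abs P measurableT (measurable_int P intf)) => [N [mN N0 fN]].
exists N; split=> // x /= fx; apply: fN => /= e; apply: fx.
by have [] := e I.
Qed.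

(** The difference is measurable for the sigma-algebra of U, so the events where it is positive or
    negative belong to it, and the difference integrates to 0 over both. *)
Lemma cond_exp_unique k n (X : T -> 'cV[R]_k) (U : T -> 'cV[R]_n)
    (S S' : T -> 'cV[R]_k) : random_vector U ->
  is_cond_exp P X U S -> is_cond_exp P X U S' ->
  forall i, \forall t \ae P, coord S i t = coord S' i t.
Proof.
move=> mU vS vS' i; have [mS iS eS] := vS i; have [mS' iS' eS'] := vS' i.
have iD : P.-integrable setT (EFin \o (fun t => coord S i t - coord S' i t)).
  exact: (integrableB measurableT iS iS').
pose G := \big[setU/set0]_(i < n) preimage_set_system setT (coord U i) measurable.
have mD : measurable_fun setT
    ((fun t => coord S i t - coord S' i t) : g_sigma_algebraType G -> R).
  by apply: measurable_funB => _ C mC; [apply: mS|apply: mS']; exists C.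
have mG A : sigma_rv U A -> measurable A by exact: sigma_rv_measurable.
have D0 A : sigma_rv U A -> \int[P]_(x in A) (coord S i x - coord S' i x) = 0.
  move=> UA; rewrite RintegralB//; [|exact: mG|
    exact: integrableS (mG _ UA) _ iS|exact: integrableS (mG _ UA) _ iS'].
  by rewrite /Rintegral eS// eS'// subrr.
have [||N [mN N0 fN]] := ae_eq0_of_sign_integrals iD.
- apply: D0; have := mD measurableT `]0, +oo[%classic (measurable_itv _).
  by rewrite setTI; congr (sigma_rv U _); apply/seteqP; split => x /=; rewrite in_itv/= andbT.
- apply: D0; have := mD measurableT `]-oo, 0[%classic (measurable_itv _).
  by rewrite setTI; congr (sigma_rv U _); apply/seteqP; split => x /=; rewrite in_itv.
exists N; split=> // x /= fx; apply: fN => /= e; apply: fx.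
by apply/eqP; rewrite -subr_eq0 e.
Qed.

(** K U is itself a version, by Fourier uniqueness applied to X - K U. Hence [xget] picks a genuine
    version, which agrees with K U almost surely. *)
Lemma cond_exp_linear k n (X : T -> 'cV[R]_k) (U : T -> 'cV[R]_n) (K : 'M[R]_(k, n)) :
  random_vector U ->
  (forall i, P.-integrable setT (EFin \o coord X i)) ->
  (forall i, P.-integrable setT (EFin \o coord U i)) ->
  (forall i (s : 'I_n -> R) c, \int[P]_t
     (coord (fun t => X t - K *m U t) i t * cos (\sum_j s j * coord U j t + c)) = 0) ->
  forall i, measurable_fun setT (coord (cond_exp P X U) i) /\
    \forall t \ae P, coord (cond_exp P X U) i t = coord (fun t => K *m U t) i t.
Proof.
move=> mU iX iU orth.
have SE i : coord (fun t => K *m U t) i = fun t => \sum_j K i j * coord U j t.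
  by apply/funext => t; rewrite /coord mxE.
have iS i : P.-integrable setT (EFin \o coord (fun t => K *m U t) i).
  rewrite SE (_ : _ \o _ = (fun t => (\sum_j (K i j * coord U j t)%:E)%E)); last first.
    by apply/funext => t /=; rewrite sumEFin.
  apply: (@integrable_sum _ _ _ _ _ measurableT _ _ xpredT (fun j t => (K i j * coord U j t)%:E)).
  by move=> j _; exact: (integrableZl measurableT _ (iU j)).
have vS : is_cond_exp P X U (fun t => K *m U t).
  move=> i; split=> //.
    by move=> _ [B mB <-]; rewrite setTI SE; exact: sigma_rv_linear.
  move=> A UA; have mA := sigma_rv_measurable mU UA.
  have iD : P.-integrable setT (EFin \o coord (fun t => X t - K *m U t) i).
    have := integrableB measurableT (iX i) (iS i).
    by congr (P.-integrable _ _); apply/funext => t; rewrite /= /Defs.coord !mxE.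
  have := fourier_uniqueness_vector mU iD (orth i) UA.
  have -> : \int[P]_(x in A) coord (fun t => X t - K *m U t) i x =
      \int[P]_(x in A) (coord X i x - coord (fun t => K *m U t) i x).
    by apply: eq_Rintegral => t _; rewrite /coord !mxE.
  have iXA := integrableS measurableT mA (@subsetT _ A) (iX i).
  have iSA := integrableS measurableT mA (@subsetT _ A) (iS i).
  rewrite RintegralB// => /eqP; rewrite subr_eq0 => /eqP e.
  rewrite -[LHS]fineK; last exact: integrable_fin_num.
  rewrite -[RHS]fineK; last exact: integrable_fin_num.
  by congr EFin.
have vE : is_cond_exp P X U (cond_exp P X U).
  by apply: (@xgetPex _ (fun=> 0) [set S | is_cond_exp P X U S]); exists (fun t => K *m U t).
move=> i; split; last exact: cond_exp_unique.
by have [_ /(measurable_int P)/measurable_EFinP] := vE i.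
Qed.

End cond_exp_versions.

(** * Positive definite matrices *)

Section definite_matrices.
Context {R : realType}.

Definition bform p q (u : 'cV[R]_p) (A : 'M[R]_(p, q)) (v : 'cV[R]_q) : R :=
  (u^T *m A *m v) ord0 ord0.

Lemma bformDl p q (u u' : 'cV[R]_p) (A : 'M[R]_(p, q)) v :
  bform (u + u') A v = bform u A v + bform u' A v.
Proof. by rewrite /bform linearD/= !mulmxDl mxE. Qed.

Lemma bformDr p q (u : 'cV[R]_p) (A : 'M[R]_(p, q)) v v' :
  bform u A (v + v') = bform u A v + bform u A v'.
Proof. by rewrite /bform mulmxDr mxE. Qed.

Lemma bformNl p q (u : 'cV[R]_p) (A : 'M[R]_(p, q)) v :
  bform (- u) A v = - bform u A v.
Proof. by rewrite /bform linearN/= !mulNmx mxE. Qed.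

Lemma bformNr p q (u : 'cV[R]_p) (A : 'M[R]_(p, q)) v :
  bform u A (- v) = - bform u A v.
Proof. by rewrite /bform mulmxN mxE. Qed.

Lemma bformZl p q a (u : 'cV[R]_p) (A : 'M[R]_(p, q)) v :
  bform (a *: u) A v = a * bform u A v.
Proof. by rewrite /bform linearZ/= -!scalemxAl mxE. Qed.

Lemma bformZr p q a (u : 'cV[R]_p) (A : 'M[R]_(p, q)) v :
  bform u A (a *: v) = a * bform u A v.
Proof. by rewrite /bform -scalemxAr mxE. Qed.

Lemma bformDm p q (u : 'cV[R]_p) (A B : 'M[R]_(p, q)) v :
  bform u (A + B) v = bform u A v + bform u B v.
Proof. by rewrite /bform mulmxDr mulmxDl mxE. Qed.

Lemma bformNm p q (u : 'cV[R]_p) (A : 'M[R]_(p, q)) v :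
  bform u (- A) v = - bform u A v.
Proof. by rewrite /bform mulmxN mulNmx mxE. Qed.

Lemma bformZm p q a (u : 'cV[R]_p) (A : 'M[R]_(p, q)) v :
  bform u (a *: A) v = a * bform u A v.
Proof. by rewrite /bform -scalemxAr -scalemxAl mxE. Qed.

Lemma bform_tr p q (u : 'cV[R]_p) (A : 'M[R]_(p, q)) v :
  bform u A v = bform v A^T u.
Proof.
rewrite /bform -[in LHS](trmxK (u^T *m A *m v)) [in LHS]mxE.
by rewrite !trmx_mul trmxK mulmxA.
Qed.

Lemma bform_sym p (u v : 'cV[R]_p) (A : 'M[R]_p) : A^T = A ->
  bform u A v = bform v A u.
Proof. by move=> sA; rewrite bform_tr sA. Qed.

Lemma bform_delta p (A : 'M[R]_p) i j : bform (delta_mx i ord0) A (delta_mx j ord0) = A i j.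
Proof. by rewrite /bform trmx_delta -rowE -colE !mxE. Qed.

Lemma bform_mul p q r s (u : 'cV[R]_p) (B : 'M[R]_(q, p)) (A : 'M[R]_(q, r))
    (C : 'M[R]_(r, s)) v : bform (B *m u) A (C *m v) = bform u (B^T *m A *m C) v.
Proof. by rewrite /bform trmx_mul !mulmxA. Qed.

Lemma bform1_gt0 p (v : 'cV[R]_p) : v != 0 -> 0 < bform v 1%:M v.
Proof.
move=> v0; rewrite /bform mulmx1 mxE.
have [i vi] : exists i, v i ord0 != 0.
  apply/existsP; apply: contraNT v0; rewrite negb_exists => /forallP h.
  apply/eqP/matrixP => i j; rewrite (ord1 j) !mxE.
  by apply/eqP; rewrite -[_ == _]negbK; exact: h.
rewrite (bigD1 i)//= mxE ltr_pwDl//.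
  by rewrite -expr2 exprn_even_gt0.
by apply: sumr_ge0 => j _; rewrite mxE -expr2 sqr_ge0.
Qed.

Lemma pdmx_psd p (A : 'M[R]_p) : pdmx A -> psdmx A.
Proof.
move=> [sA A0]; split=> // v; have [->|v0] := eqVneq v 0; last exact/ltW/A0.
by rewrite mulmx0 mxE.
Qed.

Lemma psdmxD p (A B : 'M[R]_p) : psdmx A -> psdmx B -> psdmx (A + B).
Proof.
move=> [sA A0] [sB B0]; split; first by rewrite linearD/= sA sB.
by move=> v; rewrite -/(bform _ _ _) bformDm addr_ge0// ?A0 ?B0.
Qed.

Lemma pdmxD p (A B : 'M[R]_p) : pdmx A -> psdmx B -> pdmx (A + B).
Proof.
move=> [sA A0] [sB B0]; split; first by rewrite linearD/= sA sB.
by move=> v v0; rewrite -/(bform _ _ _) bformDm ltr_pwDl ?A0 ?B0.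
Qed.

Lemma psdmx0 p : psdmx (0 : 'M[R]_p).
Proof. by split; [exact: trmx0|move=> v; rewrite mulmx0 mul0mx mxE]. Qed.

Lemma psdmx_sum p I (r : seq I) (Q : pred I) (F : I -> 'M[R]_p) :
  (forall i, psdmx (F i)) -> psdmx (\sum_(i <- r | Q i) F i).
Proof.
by move=> F0; apply: big_ind => [||i _]; [exact: psdmx0|exact: psdmxD|exact: F0].
Qed.

Lemma psdmx_congr p q (A : 'M[R]_p) (B : 'M[R]_(p, q)) : psdmx A ->
  psdmx (B^T *m A *m B).
Proof.
move=> [sA A0]; split; first by rewrite !trmx_mul trmxK sA mulmxA.
by move=> v; rewrite -/(bform _ _ _) -bform_mul; exact: A0.
Qed.

Lemma pdmx_unit p (A : 'M[R]_p) : pdmx A -> A \in unitmx.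
Proof.
move=> [sA A0]; rewrite -row_free_unit; apply: inj_row_free => v vA.
apply/eqP; apply/negPn/negP => v0.
have v0' : v^T != 0 by rewrite trmx_eq0.
by have := A0 _ v0'; rewrite trmxK vA mul0mx mxE ltxx.
Qed.

Lemma trmx_inv_sym p (A : 'M[R]_p) : A^T = A -> (invmx A)^T = invmx A.
Proof. by move=> sA; rewrite trmx_inv sA. Qed.

Lemma bform_inv p (A : 'M[R]_p) u v : A^T = A -> A \in unitmx ->
  bform u (invmx A) v = bform (invmx A *m u) A (invmx A *m v).
Proof.
by move=> sA uA; rewrite bform_mul trmx_inv_sym// mulVmx// mul1mx.
Qed.

Lemma pdmx_inv p (A : 'M[R]_p) : pdmx A -> pdmx (invmx A).
Proof.
move=> pA; have uA := pdmx_unit pA; have [sA A0] := pA; split; first exact: trmx_inv_sym.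
move=> v v0; rewrite -/(bform _ _ _) bform_inv//; apply: A0.
by apply: contra_neq v0 => e; rewrite -[v](mulKVmx uA) e mulmx0.
Qed.

(* v' A^-1 v - v' B^-1 v = (z - w)' A (z - w) + w' (B - A) w with z = A^-1 v and
   w = B^-1 v. *)
Lemma bform_invB p (A B : 'M[R]_p) v : pdmx A -> pdmx B ->
  bform v (invmx A - invmx B) v =
  bform (invmx A *m v - invmx B *m v) A (invmx A *m v - invmx B *m v) +
  bform (invmx B *m v) (B - A) (invmx B *m v).
Proof.
move=> pA pB; have uA := pdmx_unit pA; have uB := pdmx_unit pB.
have [sA _] := pA; have [sB _] := pB.
rewrite !bformDm !bformNm !bformDl !bformDr !bformNl !bformNr !(bform_inv _ _ _ uA)//.
rewrite (bform_inv _ _ _ uB)//.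
have e1 : bform (invmx A *m v) A (invmx B *m v) = bform (invmx B *m v) B (invmx B *m v).
  by rewrite !bform_mul !trmx_inv_sym// !mulVmx// !mul1mx.
rewrite (bform_sym (invmx B *m v))// e1; ring.
Qed.

Lemma pdmx_le p (A B : 'M[R]_p) : pdmx A -> loewner_le A B -> pdmx B.
Proof. by move=> pA AB; rewrite -(subrK A B) addrC; exact: pdmxD. Qed.

Lemma loewner_le_inv p (A B : 'M[R]_p) : pdmx A -> loewner_le A B ->
  loewner_le (invmx B) (invmx A).
Proof.
move=> pA AB; have pB := pdmx_le pA AB.
have [sA _] := pA; have [sB _] := pB; split.
  by rewrite linearB/= !trmx_inv_sym.
move=> v; rewrite -/(bform _ _ _) bform_invB// addr_ge0//.
  by have [_ ->] := pdmx_psd pA.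
by have [_ ->] := AB.
Qed.

Lemma loewner_lt_inv p (A B : 'M[R]_p) : pdmx A -> loewner_lt A B ->
  loewner_lt (invmx B) (invmx A).
Proof.
move=> pA AB; have pB := pdmx_le pA (pdmx_psd AB).
have [sA _] := pA; have [sB _] := pB; split.
  by rewrite linearB/= !trmx_inv_sym.
move=> v v0; rewrite -/(bform _ _ _) bform_invB// ltr_wpDl//.
  by have [_ ->] := pdmx_psd pA.
have [_] := AB; apply.
by apply: contra_neq v0 => e; rewrite -[v](mulKVmx (pdmx_unit pB)) e mulmx0.
Qed.

(** As v A v = 0, the form at w + t v is affine in t. A nonzero slope would let some t bring it to
    the value -1; this is the t chosen below. *)
Lemma psdmx_kernel p (A : 'M[R]_p) v : psdmx A -> bform v A v = 0 -> A *m v = 0.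
Proof.
move=> [sA A0] vAv.
have h (w : 'cV[R]_p) : bform w A v = 0.
  apply/eqP; apply/negPn/negP => wAv.
  have qw t : 0 <= bform w A w + 2 * t * bform w A v.
    have := A0 (w + t *: v); rewrite -/(bform _ _ _) !bformDl !bformDr.
    rewrite !bformZl !bformZr vAv (bform_sym v w sA) !mulr0 addr0.
    by move=> h; apply: (le_trans h); rewrite le_eqVlt; apply/orP; left; apply/eqP; ring.
  have := qw (- (bform w A w + 1) / (2 * bform w A v)).
  rewrite (_ : bform w A w + _ = - 1); last by field.
  by rewrite oppr_ge0 ler10.
apply/matrixP => i j; rewrite (ord1 j) [RHS]mxE.
by have := h (delta_mx i ord0); rewrite /bform trmx_delta -rowE -row_mul mxE.
Qed.

End definite_matrices.

(** * Strict monotonicity of the determinant *)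

Section determinant_monotone.
Context {R : realType}.

Let corner n (A : 'M[R]_(1 + n)) : R := A ord0 ord0.

Let schur n (A : 'M[R]_(1 + n)) : 'M[R]_n :=
  drsubmx A - (corner A)^-1 *: (dlsubmx A *m ursubmx A).

Let ulsubmxE n (A : 'M[R]_(1 + n)) : ulsubmx A = (corner A)%:M.
Proof.
by rewrite [LHS]mx11_scalar !mxE !lshift0.
Qed.

Let det_schur n (A : 'M[R]_(1 + n)) : corner A != 0 ->
  \det A = corner A * \det (schur A).
Proof.
move=> a0.
have E : A = block_mx 1%:M 0 ((corner A)^-1 *: dlsubmx A) 1%:M *m
    block_mx (corner A)%:M (ursubmx A) 0 (schur A).
  rewrite mulmx_block !mul1mx !mul0mx !addr0.
  rewrite -!scalemxAl mul_mx_scalar scalerA mulVf// scale1r.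
  by rewrite addrC subrK -ulsubmxE submxK.
by rewrite {1}E det_mulmx det_lblock det_ublock !det1 !mul1r det_scalar1.
Qed.

Let bform_block n (A : 'M[R]_(1 + n)) s (v : 'cV[R]_n) : A^T = A ->
  bform (col_mx s%:M v) A (col_mx s%:M v) =
  corner A * s ^+ 2 + 2 * s * (ursubmx A *m v) ord0 ord0 + bform v (drsubmx A) v.
Proof.
move=> sA; rewrite /bform tr_col_mx tr_scalar_mx.
rewrite -[in LHS](submxK A) mul_row_block mul_row_col !mulmxDl ulsubmxE.
have -> : dlsubmx A = (ursubmx A)^T by rewrite trmx_ursub sA.
rewrite !mul_scalar_mx !mul_mx_scalar -!scalemxAl -trmx_mul !mxE eqxx mulr1n.
ring.
Qed.

Let bform_schur n (A : 'M[R]_(1 + n)) (v : 'cV[R]_n) : A^T = A ->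
  bform v (schur A) v = bform v (drsubmx A) v -
    (corner A)^-1 * (ursubmx A *m v) ord0 ord0 ^+ 2.
Proof.
move=> sA; rewrite bformDm bformNm; congr (_ - _).
have -> : dlsubmx A = (ursubmx A)^T by rewrite trmx_ursub sA.
rewrite /bform -scalemxAr -scalemxAl mxE; congr (_ * _).
rewrite mulmxA -trmx_mul -mulmxA; set w := ursubmx A *m v.
by rewrite mxE big_ord1 mxE expr2.
Qed.

(** Completing the square in the first coordinate s: the form of the Schur complement is the minimum
    over s of the form of A. Definiteness and monotonicity of Schur complements both follow from
    this. *)
Let bform_schur_le n (A : 'M[R]_(1 + n)) s (v : 'cV[R]_n) : A^T = A -> 0 < corner A ->
  bform v (schur A) v <= bform (col_mx s%:M v) A (col_mx s%:M v) ?= iff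
    (s == - (corner A)^-1 * (ursubmx A *m v) ord0 ord0).
Proof.
move=> sA a0; rewrite bform_block// bform_schur//.
set b := (_ *m v) _ _; set a := corner A; set c := bform _ _ _.
have -> : a * s ^+ 2 + 2 * s * b + c = (c - a^-1 * b ^+ 2) + a * (s + a^-1 * b) ^+ 2.
  by field; rewrite gt_eqF.
split; first by rewrite lerDl mulr_ge0 ?sqr_ge0// ltW.
rewrite -[X in X == _]addr0 (inj_eq (addrI _)) eq_sym mulf_eq0 gt_eqF//=.
by rewrite expf_eq0/= addr_eq0 mulNr.
Qed.

Let corner_gt0 n (A : 'M[R]_(1 + n)) : pdmx A -> 0 < corner A.
Proof.
move=> [_ /(_ (delta_mx ord0 ord0))]; rewrite -/(bform _ _ _) bform_delta; apply.
by apply/eqP => /matrixP /(_ ord0 ord0); rewrite !mxE => /eqP; rewrite oner_eq0.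
Qed.

Let schur_sym n (A : 'M[R]_(1 + n)) : A^T = A -> (schur A)^T = schur A.
Proof.
move=> sA; rewrite /schur linearB/= linearZ/= trmx_mul.
by rewrite trmx_drsub trmx_ursub trmx_dlsub sA.
Qed.

Let schur_pd n (A : 'M[R]_(1 + n)) : pdmx A -> pdmx (schur A).
Proof.
move=> pA; have [sA A0] := pA; split; first exact: schur_sym.
move=> v v0; rewrite -/(bform _ _ _).
set s := - (corner A)^-1 * (ursubmx A *m v) ord0 ord0.
have [_ e] := bform_schur_le s v sA (corner_gt0 pA).
move: e; rewrite [RHS]eqxx => /eqP ->; apply: A0.
by apply: contra_neq v0; rewrite -[0]col_mx0 => /eq_col_mx [].
Qed.

(** At the minimizer s for B, the minimum for A is at most the form of A, which is below the form of
    B, which is the minimum for B. *)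
Let schur_lt n (A B : 'M[R]_(1 + n)) : pdmx A -> loewner_lt A B ->
  loewner_lt (schur A) (schur B).
Proof.
move=> pA AB; have pB := pdmx_le pA (pdmx_psd AB).
have [sA _] := pA; have [sB _] := pB; split.
  by rewrite linearB/= !schur_sym.
move=> v v0; rewrite -/(bform _ _ _) bformDm bformNm subr_gt0.
set s := - (corner B)^-1 * (ursubmx B *m v) ord0 ord0.
have [_ e] := bform_schur_le s v sB (corner_gt0 pB).
move: e; rewrite [RHS]eqxx => /eqP ->.
have [h _] := bform_schur_le s v sA (corner_gt0 pA); apply: (le_lt_trans h).
rewrite -subr_gt0 -bformNm -bformDm; have [_] := AB; apply.
by apply: contra_neq v0; rewrite -[0]col_mx0 => /eq_col_mx [].
Qed.

Lemma pdmx_det_gt0 n (A : 'M[R]_n) : pdmx A -> 0 < \det A.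
Proof.
elim: n A => [A _|n ih A pA]; first by rewrite det_mx00.
rewrite (@det_schur n A) ?gt_eqF ?corner_gt0// mulr_gt0 ?corner_gt0//.
exact/ih/schur_pd.
Qed.

(** The determinant is the corner times the determinant of the Schur complement, and both positive
    factors increase strictly. The induction starts at size 1, as all determinants of size 0 equal
    1. *)
Lemma pdmx_det_lt n (A B : 'M[R]_n) : (0 < n)%N -> pdmx A -> loewner_lt A B ->
  \det A < \det B.
Proof.
case: n A B => // n A B _ pA AB; have pB := pdmx_le pA (pdmx_psd AB).
elim: n A B pA AB pB => [|n ih] A B pA AB pB; have := @corner_gt0 _ _ AB;
  rewrite /corner !mxE subr_gt0 => cAB; first by rewrite !det_mx11.
rewrite (@det_schur n.+1 A) ?gt_eqF ?(corner_gt0 pA)//.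
rewrite (@det_schur n.+1 B) ?gt_eqF ?(corner_gt0 pB)//.
apply: ltr_pM => //; try exact/ltW/corner_gt0.
  by apply/ltW/pdmx_det_gt0; exact: (@schur_pd n.+1).
by apply: ih; [exact: (@schur_pd n.+1)|exact: (@schur_lt n.+1)|exact: (@schur_pd n.+1)].
Qed.

End determinant_monotone.

(** * Limits of matrices *)

Section matrix_limits.
Context {R : realType}.

Lemma cvg_mx m n (F : nat -> 'M[R]_(m, n)) (A : 'M[R]_(m, n)) :
  (forall i j, F k i j @[k --> \oo] --> A i j) -> F k @[k --> \oo] --> A.
Proof.
move=> FA; apply/cvg_mx_entourageP => E entE.
rewrite near_map; apply: filter_forall => i; apply: filter_forall => j.
have /cvg_entourageP/(_ _ entE) := FA i j; rewrite near_map.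
by apply: filterS => k; exact: mem_set.
Qed.

Lemma cvg_mx_entry m n (F : nat -> 'M[R]_(m, n)) (A : 'M[R]_(m, n)) i j :
  F k @[k --> \oo] --> A -> F k i j @[k --> \oo] --> A i j.
Proof.
move=> /cvg_mx_entourageP FA; apply/cvg_entourageP => E entE.
have := FA _ entE; rewrite !near_map.
by apply: filterS => k /(_ i j) /set_mem.
Qed.

Lemma cvg_det n (F : nat -> 'M[R]_n) (A : 'M[R]_n) :
  F k @[k --> \oo] --> A -> \det (F k) @[k --> \oo] --> \det A.
Proof.
move=> FA; rewrite /determinant.
apply: cvg_big => [|s _]; first exact: add_continuous.
apply: cvgM; first exact: cvg_cst.
apply: cvg_big => [|i _]; first exact: mul_continuous.
exact: cvg_mx_entry.
Qed.

(** Stated on row vectors to match [rV_compact], used for the unit sphere. *)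
Lemma bform_continuous n (A : 'M[R]_n) : continuous (fun v : 'rV[R]_n => bform v^T A v^T).
Proof.
rewrite (_ : (fun _ => _) =
    fun v : 'rV[R]_n => \sum_j (\sum_i v ord0 i * A i j) * v ord0 j); last first.
  apply/funext => v; rewrite /bform trmxK mxE.
  by apply: eq_bigr => j _; rewrite !mxE.
move=> v; have fv : Filter (nbhs v) by exact: nbhs_filter.
apply: cvg_big => [|j _]; first exact: add_continuous.
apply: cvgM; last exact: coord_continuous.
apply: cvg_big => [|i _]; first exact: add_continuous.
by apply: cvgM; [exact: coord_continuous|exact: cvg_cst].
Qed.

(* The minimum of the Rayleigh quotient is attained and is an eigenvalue. *)
Lemma lambda_min_le n (A : 'M[R]_n) v : (0 < n)%N -> A^T = A ->
  lambda_min A * bform v 1%:M v <= bform v A v.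
Proof.
case: n A v => // n A v _ sA.
pose S := [set w : 'rV[R]_n.+1 | bform w^T 1%:M w^T = 1].
have Scpt : compact S.
  have cB := @rV_compact R n.+1 (fun=> `[-1, 1]%classic) (fun=> @segment_compact R (-1) 1).
  apply: (subclosed_compact _ cB).
    apply: (closed_comp _ (@closed_eq R 1)) => w _; exact: bform_continuous.
  move=> w /= w1 i /=; rewrite in_itv/= -ler_norml -(@ler_sqr _ _ 1) ?nnegrE//.
  rewrite expr1n real_normK ?num_real//.
  move: w1; rewrite /S /= /bform trmxK mulmx1 mxE => <-; rewrite (bigD1 i)//= mxE -expr2 lerDl.
  by apply: sumr_ge0 => j _; rewrite mxE -expr2 sqr_ge0.
have S0 : S !=set0.
  exists (delta_mx 0 0); rewrite /S /= trmx_delta bform_delta mxE eqxx//.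
have [c /set_mem Sc cmin] := compact_EVT_min S0 Scpt (continuous_subspaceT (@bform_continuous n.+1 A)).
set a := bform c^T A c^T in cmin.
have amin w : a * bform w 1%:M w <= bform w A w.
  have [->|w0] := eqVneq w 0.
    by rewrite /bform !mulmx0 !mxE mulr0.
  set q := bform w 1%:M w; have q0 : 0 < q by exact: bform1_gt0.
  pose z := (Num.sqrt q)^-1 *: w.
  have sq : (Num.sqrt q)^-1 ^+ 2 = q^-1 by rewrite exprVn sqr_sqrtr// ltW.
  have zS : S z^T by rewrite /S/= trmxK bformZl bformZr mulrA -expr2 sq -/q mulVf// gt_eqF.
  have := cmin _ (mem_set zS); rewrite trmxK bformZl bformZr mulrA -expr2 sq.
  by rewrite mulrC ler_pdivlMr.
(* A - a I is semidefinite and its form vanishes at the minimizer c, so [psdmx_kernel] makes c an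
   eigenvector; symmetry of A turns it into the row eigenvector that [eigenvalue] asks for. *)
have psdAa : psdmx (A - a%:M).
  split; first by rewrite linearB/= sA tr_scalar_mx.
  move=> w; rewrite -/(bform _ _ _) bformDm bformNm subr_ge0 -scalemx1.
  by rewrite bformZm.
have eigA : eigenvalue A a.
  apply/eigenvalueP; exists c; last first.
    by apply: contra_eq_neq Sc => ->; rewrite /bform trmx0 mulmx0 mxE eq_sym oner_eq0.
  have : (A - a%:M) *m c^T = 0.
    apply: psdmx_kernel => //; rewrite bformDm bformNm -/a -scalemx1.
    by rewrite bformZm Sc mulr1 subrr.
  move=> /(congr1 trmx); rewrite trmx_mul trmxK linearB/= sA tr_scalar_mx mulmxBr trmx0.
  by move=> /eqP; rewrite subr_eq0 mul_mx_scalar => /eqP.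
(* The set of eigenvalues must be bounded below for its infimum to be a genuine one. *)
have lb : lbound [set x | eigenvalue A x] a.
  move=> x /= /eigenvalueP [u uA u0].
  have u1 : 0 < bform u^T 1%:M u^T by apply: bform1_gt0; rewrite trmx_eq0.
  have := amin u^T; rewrite {2}/bform trmxK uA -scalemxAl mxE.
  have -> : (u *m u^T) ord0 ord0 = bform u^T 1%:M u^T by rewrite /bform trmxK mulmx1.
  by rewrite ler_pM2r.
have le_a : lambda_min A <= a by apply: ge_inf => //; exists a.
apply: le_trans (amin v); apply: ler_wpM2r => //.
have [->|v0] := eqVneq v 0; first by rewrite /bform mulmx0 mxE.
by rewrite ltW// bform1_gt0.
Qed.

End matrix_limits.

(** * The linear Gaussian model *)

Section linear_gaussian_model.
Context d (T : measurableType d) (R : realType) (P : probability T R).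
Variables (k : nat) (n : nat -> nat) (X : T -> 'cV[R]_k) (SigmaX : 'M[R]_k).
Variables (Rcov : forall j : nat, 'M[R]_(n j)) (W : forall j : nat, T -> 'cV[R]_(n j)).
Hypothesis X_gauss : gaussian_vector P X 0 SigmaX.
Hypothesis W_gauss : forall j, gaussian_vector P (W j) 0 (Rcov j).
Hypothesis XW_indep : mutually_independent P (fun o : option nat =>
  if o is Some j then sigma_rv (W j) else sigma_rv X).

(** A general linear form in X and the first m noises. The coefficients v are indexed by all
    naturals, which avoids casts between the dimensions [n j]. *)
Definition noise_form m (u : 'cV[R]_k) (v : forall j, 'cV[R]_(n j)) (t : T) : R :=
  (u^T *m X t) ord0 ord0 + \sum_(j < m) ((v j)^T *m W j t) ord0 ord0.

Definition noise_cov m (u : 'cV[R]_k) (v : forall j, 'cV[R]_(n j))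
    (u' : 'cV[R]_k) (v' : forall j, 'cV[R]_(n j)) : R :=
  bform u SigmaX u' + \sum_(j < m) bform (v j) (Rcov j) (v' j).

Let linearE p (u : 'cV[R]_p) (Y : T -> 'cV[R]_p) :
  (fun t => (u^T *m Y t) ord0 ord0) = (fun t => \sum_i u i ord0 * coord Y i t).
Proof. by apply/funext => t; rewrite mxE; apply: eq_bigr => i _; rewrite mxE. Qed.

Let gaussian_form p (Y : T -> 'cV[R]_p) (S : 'M[R]_p) u : gaussian_vector P Y 0 S ->
  gauss_form P (fun t => (u^T *m Y t) ord0 ord0) (bform u S u).
Proof.
move=> [mY [_ S0] lawY]; apply: gauss_form_normal_law.
- by rewrite linearE; apply: measurable_sum => i; exact: measurable_funM.
- exact: S0.
- by move=> A mA; rewrite lawY// mulmx0 mxE.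
Qed.

Lemma noise_form_gauss m u v : gauss_form P (noise_form m u v) (noise_cov m u v u v).
Proof.
pose L (o : option nat) t := if o is Some j then ((v j)^T *m W j t) ord0 ord0
  else (u^T *m X t) ord0 ord0.
pose q (o : option nat) := if o is Some j then bform (v j) (Rcov j) (v j)
  else bform u SigmaX u.
pose r : seq (option nat) := None :: [seq Some j | j <- index_iota 0 m].
have ur : uniq r.
  rewrite /r /= map_inj_uniq ?iota_uniq ?andbT; last by move=> i j [].
  by apply/negP => /mapP [].
have mX : random_vector X by have [] := X_gauss.
have mW j : random_vector (W j) by have [] := W_gauss j.
have := gauss_form_sum (L := L) (q := q) _ XW_indep _ _ ur.
rewrite /noise_form /noise_cov.
have -> : (fun t => \sum_(o <- r) L o t) = noise_form m u v.
  by apply/funext => t; rewrite big_cons big_map big_mkord.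
rewrite big_cons big_map big_mkord; apply.
- by move=> [j|]; exact: sigma_rv_measurable.
- by move=> [j|] B mB; rewrite /L linearE; exact: sigma_rv_linear.
- by move=> [j|]; exact: gaussian_form.
Qed.

Hypothesis SigmaX_sym : SigmaX^T = SigmaX.
Hypothesis Rcov_sym : forall j, (Rcov j)^T = Rcov j.

Lemma noise_formD m u v u' v' t : noise_form m u v t + noise_form m u' v' t =
  noise_form m (u + u') (fun j => v j + v' j) t.
Proof.
have D p (a b y : 'cV[R]_p) :
    ((a + b)^T *m y) ord0 ord0 = (a^T *m y) ord0 ord0 + (b^T *m y) ord0 ord0.
  by rewrite linearD/= mulmxDl [LHS]mxE.
rewrite /noise_form D addrACA; congr (_ + _).
by rewrite -big_split/=; apply: eq_bigr => j _; rewrite D.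
Qed.

Lemma noise_formZ m a u v t : a * noise_form m u v t =
  noise_form m (a *: u) (fun j => a *: v j) t.
Proof.
have Z p (b y : 'cV[R]_p) : ((a *: b)^T *m y) ord0 ord0 = a * (b^T *m y) ord0 ord0.
  by rewrite linearZ/= -scalemxAl [LHS]mxE.
rewrite /noise_form Z mulrDr; congr (_ + _).
by rewrite mulr_sumr; apply: eq_bigr => j _; rewrite Z.
Qed.

Lemma noise_covD m u v u' v' :
  noise_cov m (u + u') (fun j => v j + v' j) (u + u') (fun j => v j + v' j) =
  noise_cov m u v u v + noise_cov m u' v' u' v' + 2 * noise_cov m u v u' v'.
Proof.
have D p (S : 'M[R]_p) a b : S^T = S ->
    bform (a + b) S (a + b) = bform a S a + bform b S b + 2 * bform a S b.
  move=> sS; rewrite bformDl !bformDr (bform_sym b a sS); ring.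
rewrite /noise_cov D//; under eq_bigr do rewrite D//.
rewrite !big_split/= -mulr_sumr; ring.
Qed.

Lemma noise_covZ m a u v :
  noise_cov m (a *: u) (fun j => a *: v j) (a *: u) (fun j => a *: v j) =
  a ^+ 2 * noise_cov m u v u v.
Proof.
rewrite /noise_cov bformZl bformZr mulrA -expr2 mulrDr; congr (_ + _).
by rewrite mulr_sumr; apply: eq_bigr => j _; rewrite bformZl bformZr mulrA -expr2.
Qed.

(** Polarization: the sum of two forms is again a form, so each of the three squares is covered by
    [gauss_form_sqr]. *)
Lemma noise_form_prod m u v u' v' :
  P.-integrable setT (EFin \o (fun t => noise_form m u v t * noise_form m u' v' t)) /\
  \int[P]_t (noise_form m u v t * noise_form m u' v' t) = noise_cov m u v u' v'.
Proof.
have [i1 e1] := gauss_form_sqr (noise_form_gauss m u v).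
have [i2 e2] := gauss_form_sqr (noise_form_gauss m u' v').
have [i3 e3] := gauss_form_sqr
  (noise_form_gauss m (u + u') (fun j => v j + v' j)).
set L := noise_form m u v in i1 e1 *; set L' := noise_form m u' v' in i2 e2 *.
set L2 := noise_form _ (u + _) _ in i3 e3.
have E t : L t * L' t = 2^-1 * (L2 t ^+ 2 - L t ^+ 2 - L' t ^+ 2).
  by rewrite /L2 -noise_formD -/(L t) -/(L' t); field.
have iB : P.-integrable setT (EFin \o (fun t => L2 t ^+ 2 - L t ^+ 2)).
  exact: (integrableB measurableT i3 i1).
have iBB : P.-integrable setT (EFin \o (fun t => L2 t ^+ 2 - L t ^+ 2 - L' t ^+ 2)).
  exact: (integrableB measurableT iB i2).
rewrite (funext E); split; first exact: (integrableZl measurableT 2^-1 iBB).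
rewrite RintegralZl// RintegralB// RintegralB// e1 e2 e3 noise_covD; by field.
Qed.

(** The decoupling lemma with A = 0 and c = 0, where the cosine is 1. *)
Lemma noise_form_mean m u v : P.-integrable setT (EFin \o noise_form m u v) /\
  \int[P]_t noise_form m u v t = 0.
Proof.
have gL := noise_form_gauss m u v; have iL := gauss_form_integrable gL.
split=> //; have [_ q0 _] := gL.
transitivity (\int[P]_t (noise_form m u v t * cos (0 + 0))).
  by apply: eq_Rintegral => t _; rewrite addr0 cos0 mulr1.
apply: (gauss_form_decoupled q0 iL (measurable_cst (0 : R)) (qA := 0)) => t.
rewrite addr0 -noise_covZ.
rewrite (_ : (fun x => _) = noise_form m (t *: u) (fun j => t *: v j)).
  exact: noise_form_gauss.
by apply/funext => x; rewrite addr0 noise_formZ.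
Qed.

(** Zero covariance removes the cross term from the variance of t L + L', which is the hypothesis of
    [gauss_form_decoupled]. *)
Lemma noise_form_uncorrelated m u v u' v' c : noise_cov m u v u' v' = 0 ->
  \int[P]_t (noise_form m u v t * cos (noise_form m u' v' t + c)) = 0.
Proof.
move=> uncor; have gL := noise_form_gauss m u v.
have [iL _] := noise_form_mean m u v; have [_ q0 _] := gL.
have [mL' _ _] := noise_form_gauss m u' v'.
apply: (gauss_form_decoupled q0 iL mL' (qA := noise_cov m u' v' u' v')) => t.
have := noise_form_gauss m (t *: u + u') (fun j => t *: v j + v' j).
rewrite noise_covD noise_covZ (_ : noise_cov m (t *: u) _ u' v' = t * noise_cov m u v u' v').
  rewrite uncor mulr0 mulr0 addr0; congr gauss_form; apply/funext => x.
  by rewrite noise_formZ noise_formD.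
rewrite /noise_cov bformZl mulrDr; congr (_ + _).
by rewrite mulr_sumr; apply: eq_bigr => j _; rewrite bformZl.
Qed.

End linear_gaussian_model.

(** * Linear algebra of the posterior covariance *)

Section posterior.
Context (R : realType) (k : nat) (n : nat -> nat) (SigmaX : 'M[R]_k).
Variables (H : forall j : nat, 'M[R]_(n j, k)) (Rcov : forall j : nat, 'M[R]_(n j)).
Hypothesis SigmaX_pd : pdmx SigmaX.
Hypothesis Rcov_pd : forall j, pdmx (Rcov j).

Definition information m : 'M[R]_k :=
  \sum_(j < m) (H j)^T *m invmx (Rcov j) *m H j.

Definition posterior_cov m : 'M[R]_k := invmx (invmx SigmaX + information m).

Definition gain m : 'M[R]_(k, \sum_(j < m) n j) :=
  \mxrow_(j < m) (posterior_cov m *m (H j)^T *m invmx (Rcov j)).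

Lemma information_psd m : psdmx (information m).
Proof. by apply: psdmx_sum => j; apply: psdmx_congr; exact/pdmx_psd/pdmx_inv. Qed.

Lemma precision_pd m : pdmx (invmx SigmaX + information m).
Proof. by apply: pdmxD; [exact: pdmx_inv|exact: information_psd]. Qed.

Lemma posterior_cov_pd m : pdmx (posterior_cov m).
Proof. exact/pdmx_inv/precision_pd. Qed.

Let C_sym m : (posterior_cov m)^T = posterior_cov m.
Proof. by have [] := posterior_cov_pd m. Qed.

Let SigmaX_sym : SigmaX^T = SigmaX.
Proof. by have [] := SigmaX_pd. Qed.

Let Rcov_sym j : (Rcov j)^T = Rcov j.
Proof. by have [] := Rcov_pd j. Qed.

Lemma information_le m1 m2 : (m1 <= m2)%N ->
  loewner_le (information m1) (information m2).
Proof.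
move=> m12; rewrite /loewner_le /information.
rewrite -!(big_mkord xpredT (fun j => (H j)^T *m invmx (Rcov j) *m H j)).
rewrite (@big_cat_nat _ _ _ m1 0 m2)//= addrAC subrr add0r.
by apply: psdmx_sum => j; apply: psdmx_congr; exact/pdmx_psd/pdmx_inv.
Qed.

(** With C the posterior covariance and J the information matrix, I - C J = C SigmaX^-1. So w^T (X -
    S) has coefficient SigmaX^-1 C w on X and - R_j^-1 H_j C w on W_j; these are [error_src] and
    [error_noise]. *)
Definition error_src m (w : 'cV[R]_k) : 'cV[R]_k := invmx SigmaX *m (posterior_cov m *m w).

Definition error_noise m (w : 'cV[R]_k) (j : nat) : 'cV[R]_(n j) :=
  - (invmx (Rcov j) *m (H j *m (posterior_cov m *m w))).

(** The inverses in the coefficients cancel SigmaX and R_j. The result vanishes when u is the sum of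
    the H_j^T v_j, which is the case for linear forms in the observations. *)
Lemma error_noise_cov m w u v :
  noise_cov SigmaX Rcov m (error_src m w) (error_noise m w) u v =
  bform w (posterior_cov m) (u - \sum_(j < m) (H j)^T *m v j).
Proof.
have sumr (I : finType) (F : I -> 'cV[R]_k) (B : 'M[R]_k) :
    bform w B (\sum_i F i) = \sum_i bform w B (F i).
  by rewrite /bform mulmx_sumr summxE.
rewrite bformDr bformNr sumr -sumrN; congr (_ + _).
  rewrite /bform /error_src !trmx_mul C_sym trmx_inv_sym// mulmxKV ?pdmx_unit//.
apply: eq_bigr => j _; rewrite /error_noise bformNl; congr (- _).
by rewrite /bform !trmx_mul C_sym trmx_inv_sym// mulmxKV ?pdmx_unit// !mulmxA.
Qed.

(** The left side is C^-1 (C w). Put into [error_noise_cov], it shows that the error itself has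
    covariance C. *)
Lemma posterior_covK m w : error_src m w -
  \sum_(j < m) (H j)^T *m error_noise m w j = w.
Proof.
have E j : - ((H j)^T *m error_noise m w j) =
    (H j)^T *m invmx (Rcov j) *m H j *m (posterior_cov m *m w).
  by rewrite /error_noise mulmxN opprK !mulmxA.
rewrite /error_src -sumrN; under eq_bigr do rewrite E.
rewrite -mulmx_suml.
by rewrite -mulmxDl mulKVmx// pdmx_unit//; exact: precision_pd.
Qed.

End posterior.

(** * The estimator and its covariances *)

Section mmse.
Context d (T : measurableType d) (R : realType) (P : probability T R).
Variables (k : nat) (n : nat -> nat) (X : T -> 'cV[R]_k) (SigmaX : 'M[R]_k).
Variables (H : forall j : nat, 'M[R]_(n j, k)) (Rcov : forall j : nat, 'M[R]_(n j)).
Variables (W : forall j : nat, T -> 'cV[R]_(n j)).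
Hypothesis X_gauss : gaussian_vector P X 0 SigmaX.
Hypothesis W_gauss : forall j, gaussian_vector P (W j) 0 (Rcov j).
Hypothesis XW_indep : mutually_independent P (fun o : option nat =>
  if o is Some j then sigma_rv (W j) else sigma_rv X).
Hypothesis SigmaX_pd : pdmx SigmaX.
Hypothesis Rcov_pd : forall j, pdmx (Rcov j).

Let SigmaX_sym : SigmaX^T = SigmaX.
Proof. by have [] := SigmaX_pd. Qed.

Let Rcov_sym j : (Rcov j)^T = Rcov j.
Proof. by have [] := Rcov_pd j. Qed.

Notation Z m := (fun t => \mxcol_(j < m) (H j *m X t + W j t)).
Notation C := (posterior_cov SigmaX H Rcov).
Notation Ksrc := (error_src SigmaX H Rcov).
Notation Knoise := (error_noise SigmaX H Rcov).
Notation nform := (noise_form X W).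
Notation K := (gain SigmaX H Rcov).

Let observation_form m (v : forall j, 'cV[R]_(n j)) t :
  \sum_(j < m) ((v j)^T *m (H j *m X t + W j t)) ord0 ord0 =
  nform m (\sum_(j < m) (H j)^T *m v j) v t.
Proof.
under eq_bigr do rewrite mulmxDr mxE.
rewrite big_split/=; congr (_ + _).
rewrite linear_sum/= mulmx_suml summxE; apply: eq_bigr => j _.
by rewrite trmx_mul trmxK mulmxA.
Qed.

(** The blocks of s, extended by 0 past m, become coefficients for [noise_form]. *)
Let blocks m (s : 'cV[R]_(\sum_(j < m) n j)) : exists v : forall j, 'cV[R]_(n j),
  forall j : 'I_m, v j = submxcol s j.
Proof.
exists (fun j => if @idP (j < m)%N is ReflectT jm then submxcol s (Ordinal jm) else 0).
move=> [j jm] /=; case: {-}_ / idP => [jm'|//].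
by rewrite (bool_irrelevance jm' jm).
Qed.

Let coord_observation m (s : 'I_(\sum_(j < m) n j) -> R) :
  exists2 v : forall j, 'cV[R]_(n j), True &
  forall t, \sum_j s j * coord (Z m) j t = nform m (\sum_(j < m) (H j)^T *m v j) v t.
Proof.
have [v vE] := blocks (\col_j s j); exists v => // t.
rewrite -observation_form.
transitivity (((\col_j s j)^T *m Z m t) ord0 ord0).
  by rewrite mxE; apply: eq_bigr => j _; congr (_ * _); rewrite !mxE.
rewrite -[\col_j s j]submxcolK tr_mxcol mul_mxrow_mxcol summxE.
by apply: eq_bigr => j _; rewrite vE.
Qed.

Let gain_form m i t : coord (fun t => K m *m Z m t) i t =
  nform m (\sum_(j < m) (H j)^T *m (- Knoise m (delta_mx i ord0) j))
    (fun j => - Knoise m (delta_mx i ord0) j) t.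
Proof.
rewrite -observation_form /Defs.coord mul_mxrow_mxcol summxE; apply: eq_bigr => j _.
rewrite /error_noise opprK !trmx_mul (trmx_inv_sym (Rcov_sym j)).
have [-> _] := posterior_cov_pd H SigmaX_pd Rcov_pd m.
by rewrite trmx_delta -!mulmxA -rowE [RHS]mxE.
Qed.

Let gain_src m i : \sum_(j < m) (H j)^T *m (- Knoise m (delta_mx i ord0) j) =
  delta_mx i ord0 - Ksrc m (delta_mx i ord0).
Proof.
rewrite -[X in _ = X - _](posterior_covK H SigmaX_pd Rcov_pd m (delta_mx i ord0)).
by rewrite addrAC subrr add0r -sumrN; apply: eq_bigr => j _; rewrite mulmxN.
Qed.

Let coord_form m i t : coord X i t = nform m (delta_mx i ord0) (fun=> 0) t.
Proof.
rewrite /noise_form big1 ?addr0; first by rewrite trmx_delta -rowE mxE.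
by move=> j _; rewrite trmx0 mul0mx mxE.
Qed.

Let error_form m i t : coord (fun t => X t - K m *m Z m t) i t =
  nform m (Ksrc m (delta_mx i ord0)) (Knoise m (delta_mx i ord0)) t.
Proof.
transitivity (coord X i t - coord (fun t => K m *m Z m t) i t).
  by rewrite /Defs.coord !mxE.
rewrite gain_form (coord_form m) -mulN1r noise_formZ noise_formD gain_src.
congr nform.
  by rewrite scaleN1r opprB addrC subrK.
by apply/functional_extensionality_dep => j; rewrite scaleN1r opprK add0r.
Qed.

(** Write S_i = X_i - (X_i - S_i). The error is uncorrelated with S_j, so Cov(S_i, S_j) = Cov(X_i,
    S_j), and S_j has coefficient e_j - SigmaX^-1 C e_j on X. *)
Let gain_cov m i j :
  noise_cov SigmaX Rcov m
    (\sum_(j < m) (H j)^T *m (- Knoise m (delta_mx i ord0) j))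
    (fun l => - Knoise m (delta_mx i ord0) l)
    (\sum_(l < m) (H l)^T *m (- Knoise m (delta_mx j ord0) l))
    (fun l => - Knoise m (delta_mx j ord0) l) = (SigmaX - C m) i j.
Proof.
transitivity (bform (delta_mx i ord0) SigmaX (delta_mx j ord0 - Ksrc m (delta_mx j ord0))
  - noise_cov SigmaX Rcov m (Ksrc m (delta_mx i ord0)) (Knoise m (delta_mx i ord0))
    (\sum_(l < m) (H l)^T *m (- Knoise m (delta_mx j ord0) l))
    (fun l => - Knoise m (delta_mx j ord0) l)).
  rewrite /noise_cov !gain_src bformDl bformNl opprD addrA; congr (_ + _).
  by rewrite -sumrN; apply: eq_bigr => l _; rewrite bformNl.
rewrite error_noise_cov// subrr /bform mulmx0 [X in _ - X]mxE subr0 -/(bform _ _ _).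
rewrite bformDr bformNr bform_delta mxE [in RHS]mxE; congr (_ - _).
rewrite -bform_delta /bform /error_src -!mulmxA; congr ((_ *m _) _ _).
by rewrite mulKVmx// pdmx_unit.
Qed.

Lemma cond_exp_observation m i :
  measurable_fun setT (coord (cond_exp P X (Z m)) i) /\
  \forall t \ae P, coord (cond_exp P X (Z m)) i t =
    nform m (\sum_(j < m) (H j)^T *m (- Knoise m (delta_mx i ord0) j))
      (fun j => - Knoise m (delta_mx i ord0) j) t.
Proof.
have form_int u v : P.-integrable setT (EFin \o nform m u v).
  by have [] := noise_form_mean X_gauss W_gauss XW_indep m u v.
have iZ j : P.-integrable setT (EFin \o coord (Z m) j).
  have [v _ vE] := coord_observation (m := m) (fun l => (l == j)%:R).
  rewrite (_ : coord (Z m) j = nform m (\sum_(j0 < m) (H j0)^T *m v j0) v)//.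
  apply/funext => t; rewrite -vE (bigD1 j)//= eqxx mul1r [X in _ = _ + X]big1 ?addr0// => l /negbTE ->.
  by rewrite mul0r.
have iX l : P.-integrable setT (EFin \o coord X l).
  by rewrite (funext (coord_form m l)).
have mZ : random_vector (Z m).
  by move=> j; apply/measurable_EFinP; exact: measurable_int (iZ j).
have [|mE [N [mN N0 EN]]] := cond_exp_linear mZ iX iZ (K := K m) _ i.
  move=> l s c; have [v _ vE] := coord_observation (m := m) s.
  under eq_Rintegral do rewrite error_form vE.
  apply: (noise_form_uncorrelated X_gauss W_gauss XW_indep SigmaX_sym Rcov_sym).
  by rewrite error_noise_cov// subrr /bform mulmx0 mxE.
split=> //; exists N; split=> // t /= tN; apply: EN => /= e; apply: tN.
by rewrite e gain_form.
Qed.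

Let Rintegral_ae (f g : T -> R) : measurable_fun setT f -> measurable_fun setT g ->
  (\forall t \ae P, f t = g t) -> \int[P]_t f t = \int[P]_t g t.
Proof.
move=> mf mg fg; rewrite /Rintegral; congr fine; apply: ae_eq_integral => //.
- exact/measurable_EFinP.
- exact/measurable_EFinP.
- by apply: filterS fg => t /= -> .
Qed.

Lemma mmse_cov_observation m : mmse_cov P X (Z m) = C m.
Proof.
apply/matrixP => i j; rewrite mxE unlock.
have form_meas u v : measurable_fun setT (nform m u v).
  by have [] := noise_form_gauss X_gauss W_gauss XW_indep m u v.
have [mEi aei] := cond_exp_observation m i; have [mEj aej] := cond_exp_observation m j.
have mX l : measurable_fun setT (coord X l) by have [] := X_gauss.
transitivity (\int[P]_t ((coord X i t - coord (cond_exp P X (Z m)) i t) *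
    (coord X j t - coord (cond_exp P X (Z m)) j t))).
  rewrite /Rintegral; congr fine; apply: eq_integral => t _.
  by rewrite mxE big_ord1 !mxE.
transitivity (\int[P]_t (nform m (Ksrc m (delta_mx i ord0)) (Knoise m (delta_mx i ord0)) t *
    nform m (Ksrc m (delta_mx j ord0)) (Knoise m (delta_mx j ord0)) t)).
  apply: Rintegral_ae.
  - by apply: measurable_funM; exact: measurable_funB.
  - exact: measurable_funM.
  - near=> t.
    have ei : coord X i t - coord (cond_exp P X (Z m)) i t =
        nform m (Ksrc m (delta_mx i ord0)) (Knoise m (delta_mx i ord0)) t.
      rewrite -error_form (near aei t)// -gain_form.
      by rewrite /Defs.coord !mxE.
    have ej : coord X j t - coord (cond_exp P X (Z m)) j t =
        nform m (Ksrc m (delta_mx j ord0)) (Knoise m (delta_mx j ord0)) t.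
      rewrite -error_form (near aej t)// -gain_form.
      by rewrite /Defs.coord !mxE.
    by rewrite ei ej.
have [_ ->] := noise_form_prod X_gauss W_gauss XW_indep SigmaX_sym Rcov_sym m
  (Ksrc m (delta_mx i ord0)) (Knoise m (delta_mx i ord0))
  (Ksrc m (delta_mx j ord0)) (Knoise m (delta_mx j ord0)).
by rewrite error_noise_cov// posterior_covK// bform_delta.
Unshelve. all: by end_near. Qed.

Lemma covariance_cond_exp_observation m :
  covariance_mx P (cond_exp P X (Z m)) = SigmaX - C m.
Proof.
apply/matrixP => i j; rewrite mxE -gain_cov.
have form_meas u v : measurable_fun setT (nform m u v).
  by have [] := noise_form_gauss X_gauss W_gauss XW_indep m u v.
have [mEi aei] := cond_exp_observation m i; have [mEj aej] := cond_exp_observation m j.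
have mean0 l : fine 'E_P[coord (cond_exp P X (Z m)) l] = 0.
  have [mEl ael] := cond_exp_observation m l.
  rewrite unlock -[LHS]/(Rintegral _ _ _) (Rintegral_ae mEl _ ael)//.
  by have [] := noise_form_mean X_gauss W_gauss XW_indep m
    (\sum_(j < m) (H j)^T *m (- Knoise m (delta_mx l ord0) j))
    (fun j => - Knoise m (delta_mx l ord0) j).
rewrite covariance.unlock !mean0 unlock.
have [_ <-] := noise_form_prod X_gauss W_gauss XW_indep SigmaX_sym Rcov_sym m
    (\sum_(j < m) (H j)^T *m (- Knoise m (delta_mx i ord0) j))
    (fun l => - Knoise m (delta_mx i ord0) l)
    (\sum_(l < m) (H l)^T *m (- Knoise m (delta_mx j ord0) l))
    (fun l => - Knoise m (delta_mx j ord0) l).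
transitivity (\int[P]_t (coord (cond_exp P X (Z m)) i t * coord (cond_exp P X (Z m)) j t)).
  by rewrite /Rintegral; congr fine; apply: eq_integral => t _; rewrite fctE /= !subr0.
apply: Rintegral_ae.
- exact: measurable_funM.
- exact: measurable_funM.
- by near=> t; rewrite (near aei t)// (near aej t).
Unshelve. all: by end_near. Qed.

End mmse.

(** Both inequalities are tested at e_i, e_j and e_i + e_j. The constant 2 is not sharp but suffices
    for limits. *)
Lemma psdmx_entry_le (R : realType) p (M : 'M[R]_p) (c : R) i j : psdmx M ->
  loewner_le M c%:M -> `|M i j| <= 2 * c.
Proof.
move=> [sM M0] [_ Mc].
have ub w : bform w M w <= c * bform w 1%:M w.
  have := Mc w; rewrite -/(bform _ _ _) bformDm bformNm subr_ge0 -[c%:M]scalemx1.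
  by rewrite bformZm.
have eE l : bform (delta_mx l ord0) 1%:M (delta_mx l ord0) = 1 :> R.
  by rewrite bform_delta mxE eqxx.
have := ub (delta_mx i ord0 + delta_mx j ord0).
have := M0 (delta_mx i ord0 + delta_mx j ord0); rewrite -/(bform _ _ _).
rewrite !bformDl !bformDr !eE !bform_delta !mxE (_ : M j i = M i j); last by rewrite -{1}sM mxE.
have := ub (delta_mx i ord0); have := ub (delta_mx j ord0).
have := M0 (delta_mx i ord0); have := M0 (delta_mx j ord0).
rewrite -!/(bform _ _ _) !eE !bform_delta !mulr1 ler_norml.
by case: (eqVneq i j) => _ /=; rewrite ?mulr1n ?mulr0n => *; apply/andP; split; lra.
Qed.

Lemma cvg_powR_id1 (R : realType) (u : nat -> R) r :
  u m @[m --> \oo] --> (1 : R) -> u m `^ r @[m --> \oo] --> (1 : R).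
Proof.
move=> u1.
have -> : (1 : R) = expR (r * ln 1) by rewrite ln1 mulr0 expR0.
have c : expR (r * ln (u m)) @[m --> \oo] --> expR (r * ln 1).
  apply: (cvg_comp _ expR); last exact: continuous_expR.
  apply: cvgM; first exact: cvg_cst.
  by apply: (cvg_comp _ (@ln R)); [exact: u1|exact: continuous_ln].
apply: cvg_trans c; apply: near_eq_cvg; near=> m.
rewrite /powR gt_eqF//.
by near: m; exact: (cvgr_gt 1 u1 0 ltr01).
Unshelve. all: by end_near. Qed.

Lemma cvg_inv_pinfty (R : realType) (u : nat -> R) :
  u m @[m --> \oo] --> +oo -> (u m)^-1 @[m --> \oo] --> (0 : R).
Proof.
move=> uy; apply/cvgrPdist_le => e e0; near=> m.
have um : e^-1 <= u m by near: m; move/cvgryPge : uy; exact.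
have e10 : 0 < e^-1 by rewrite invr_gt0.
have um0 := lt_le_trans e10 um.
rewrite sub0r normrN ger0_norm ?invr_ge0 ?(ltW um0)//.
by rewrite -[leRHS]invrK lef_pV2// posrE.
Unshelve. all: by end_near. Qed.

Theorem theorem5 (d : measure_display) (T : measurableType d) (R : realType)
    (P : probability T R) (k : nat) (n : nat -> nat)
    (X : T -> 'cV[R]_k) (SigmaX : 'M[R]_k)
    (H : forall j : nat, 'M[R]_(n j, k))
    (Rcov : forall j : nat, 'M[R]_(n j))
    (W Z : forall j : nat, T -> 'cV[R]_(n j))
    (Zm : forall m : nat, T -> 'cV[R]_(\sum_(j < m) n j))
    (Sm : nat -> T -> 'cV[R]_k)
    (SigmaS J : nat -> 'M[R]_k) (G : nat -> R)
    (k_gt0 : (0 < k)%N)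
    (SigmaX_pd : loewner_lt 0 SigmaX)
    (X_gauss : gaussian_vector P X 0 SigmaX)
    (Rcov_pd : forall j, loewner_lt 0 (Rcov j))
    (W_gauss : forall j, gaussian_vector P (W j) 0 (Rcov j))
    (XW_indep : mutually_independent P (fun o : option nat =>
       if o is Some j then sigma_rv (W j) else sigma_rv X))
    (Z_def : forall j t, Z j t = H j *m X t + W j t)
    (Zm_def : forall m t, Zm m t = \mxcol_(j < m) Z j t)
    (Sm_def : forall m, Sm m = cond_exp P X (Zm m))
    (SigmaS_def : forall m, SigmaS m = covariance_mx P (Sm m))
    (J_def : forall m,
       J m = \sum_(j < m) (H j)^T *m invmx (Rcov j) *m H j)
    (G_def : forall m, G m = (\det (SigmaS m) / \det SigmaX) `^ (k%:R^-1)) :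
  (* (1) *)
  [/\ (forall m,
        [/\ mmse_cov P X (Zm m) \in unitmx,
            invmx (mmse_cov P X (Zm m)) = invmx SigmaX + J m &
            SigmaS m = SigmaX - mmse_cov P X (Zm m)]),
  (* (2) *)
      (forall m1 m2, (m1 <= m2)%N ->
        loewner_le (mmse_cov P X (Zm m2)) (mmse_cov P X (Zm m1)) /\
        loewner_le (SigmaS m1) (SigmaS m2)),
  (* (3) *)
      (forall m,
        (loewner_lt 0 (J m) <-> [set v : 'cV[R]_k | J m *m v = 0] = [set 0]) /\
        (loewner_lt 0 (J m) ->
          [/\ loewner_lt 0 (mmse_cov P X (Zm m)),
              loewner_lt (mmse_cov P X (Zm m)) SigmaX,
              loewner_lt 0 (SigmaS m),
              loewner_lt (SigmaS m) SigmaX &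
              0 < G m < 1])) &
  (* (4) *)
      (lambda_min (J m) @[m --> \oo] --> +oo ->
        [/\ mmse_cov P X (Zm m) @[m --> \oo] --> (0 : 'M[R]_k),
            SigmaS m @[m --> \oo] --> SigmaX &
            G m @[m --> \oo] --> (1 : R)])].
Proof.
have SX : pdmx SigmaX by move: SigmaX_pd; rewrite /loewner_lt subr0.
have RX j : pdmx (Rcov j) by have := Rcov_pd j; rewrite /loewner_lt subr0.
have ZmE m : Zm m = fun t => \mxcol_(j < m) (H j *m X t + W j t).
  apply/funext => t; rewrite Zm_def; apply: eq_mxcol => j.
  exact: Z_def.
pose C := posterior_cov SigmaX H Rcov.
have mmseE m : mmse_cov P X (Zm m) = C m by rewrite ZmE; exact: mmse_cov_observation.
have SE m : SigmaS m = SigmaX - C m.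
  by rewrite SigmaS_def Sm_def ZmE; exact: covariance_cond_exp_observation.
have JE m : J m = information H Rcov m by rewrite J_def.
have pC m : pdmx (C m) by exact: posterior_cov_pd.
have C_le m1 m2 : (m1 <= m2)%N -> loewner_le (C m2) (C m1).
  move=> m12; apply: loewner_le_inv; first exact: precision_pd.
  by rewrite /loewner_le opprD addrACA subrr add0r; exact: information_le.
have C_lt m : loewner_lt 0 (J m) -> loewner_lt (C m) SigmaX.
  (* The precisions are compared instead: C^-1 - SigmaX^-1 = J. *)
  move=> Jm; rewrite -[X in loewner_lt _ X]invmxK; apply: loewner_lt_inv.
    exact: pdmx_inv.
  by rewrite /loewner_lt addrAC subrr add0r -JE -[J m]subr0.
have S_lt m : loewner_lt (SigmaS m) SigmaX.
  by rewrite /loewner_lt SE opprB addrC subrK.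
have detX : 0 < \det SigmaX by exact: pdmx_det_gt0.
split.
- move=> m; rewrite mmseE; split => //; first exact: pdmx_unit.
  by rewrite /C /posterior_cov invmxK JE.
- move=> m1 m2 m12; rewrite !mmseE; split; first exact: C_le.
  by rewrite /loewner_le !SE opprB addrC subrKA; exact: C_le.
- move=> m; split.
    split=> [Jm|J0].
      apply/seteqP; split => v /=; last by move=> ->; rewrite mulmx0.
      move=> Jv; apply/eqP; apply/negPn/negP => v0.
      have [_ /(_ v v0)] := Jm; rewrite subr0 -mulmxA Jv mulmx0 mxE ltxx.
      by [].
    (* J is semidefinite in any case, so v with v^T J v = 0 lies in its kernel, which is trivial by
       assumption. *)
    have Jpsd : psdmx (J m) by rewrite JE; exact: information_psd.
    rewrite /loewner_lt subr0; have [sJ Jge] := Jpsd; split => // v v0.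
    rewrite lt_neqAle Jge andbT eq_sym; apply/eqP => vJv.
    have : [set v : 'cV[R]_k | J m *m v = 0] v by exact: psdmx_kernel.
    by rewrite J0 /= => v00; rewrite v00 eqxx in v0.
  move=> Jm; have CX := C_lt m Jm; rewrite mmseE.
  have S0 : pdmx (SigmaS m) by rewrite SE.
  split=> //; [by rewrite /loewner_lt subr0|by rewrite /loewner_lt subr0|].
  have detS := pdmx_det_gt0 S0.
  have ratio0 : 0 < \det (SigmaS m) / \det SigmaX by rewrite divr_gt0.
  rewrite G_def powR_gt0//=.
  (* Writing 1 as a power with exponent 1/k > 0 reduces G < 1 to the determinant ratio being below
     1. *)
  rewrite -[ltRHS](_ : (1 : R) `^ k%:R^-1 = 1); last by rewrite powR1.
  apply: gt0_ltr_powR; rewrite ?invr_gt0 ?ltr0n// ?nnegrE ?ltW//.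
  rewrite ltr_pdivrMr// mul1r.
  exact: pdmx_det_lt.
- move=> lam.
  have C0 : C m @[m --> \oo] --> (0 : 'M[R]_k).
    apply: cvg_mx => i j; rewrite mxE; apply/norm_cvg0P.
    have lim0 : 2 * (lambda_min (J m))^-1 @[m --> \oo] --> (0 : R).
      rewrite -(mulr0 2); apply: cvgM; first exact: cvg_cst.
      exact: cvg_inv_pinfty.
    apply: (squeeze_cvgr _ (cvg_cst 0) lim0); near=> m.
    (* Once lambda_min(J) is positive, lambda_min(J) I is definite, and inversion may reverse
       lambda_min(J) I <= J <= SigmaX^-1 + J. *)
    have l0 : 0 < lambda_min (J m) by near: m; move/cvgryPgt : lam; exact.
    rewrite normr_ge0/=; apply: psdmx_entry_le; first exact/pdmx_psd.
    rewrite (_ : _%:M = invmx (lambda_min (J m))%:M); last by rewrite invmx_scalar.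
    apply: loewner_le_inv.
      split; first exact: tr_scalar_mx.
      move=> v v0; rewrite -/(bform _ _ _) -scalemx1 bformZm mulr_gt0//.
      exact: bform1_gt0.
    rewrite /loewner_le -addrA; apply: psdmxD; first exact/pdmx_psd/pdmx_inv.
    have [sJ _] := information_psd H RX m.
    split; first by rewrite linearB/= tr_scalar_mx sJ.
    move=> v; rewrite -/(bform _ _ _) bformDm bformNm subr_ge0 -scalemx1 bformZm -JE.
    by apply: lambda_min_le => //; rewrite JE.
  have SX_lim : SigmaS m @[m --> \oo] --> SigmaX.
    rewrite (funext SE); apply: cvg_mx => i j.
    have : SigmaX i j - C m i j @[m --> \oo] --> SigmaX i j - (0 : 'M[R]_k) i j.
      by apply: cvgB; [exact: cvg_cst|exact: cvg_mx_entry].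
    rewrite mxE subr0; apply: cvg_trans; apply: near_eq_cvg; apply: nearW => m.
    by rewrite !mxE.
  split=> //; first by rewrite (funext mmseE).
  rewrite (funext G_def); apply: cvg_powR_id1.
  rewrite -(divff (lt0r_neq0 detX)); apply: cvgM; last exact: cvg_cst.
  exact: cvg_det.
Unshelve. all: by end_near. Qed.
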